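(* Let $A$ be a Hopf algebra with a bicovariant first-order differential calculus $(\Gamma,d)$, let $\{\chi_i\}$ be the associated basis of the quantum tangent space and $t_i=\chi_i*$ the corresponding left-invariant vectorfields. The contraction operator $i_{t_i}$, the Lie derivative $\ell_{t_i}$ and the exterior differential $d$ satisfy, on the algebra of exterior forms $\Gamma^{\wedge}$, $$\ell_{t_i}= i_{t_i}\, d +d\, i_{t_i},$$ that is, for every $n$ and every $n$-form $\vartheta\in\Gamma^{\wedge n}$, $\ell_{t_i}(\vartheta)=i_{t_i}(d\vartheta)+d(i_{t_i}\vartheta)$.
   Context: Conventions: repeated indices are summed. $A$ is a Hopf algebra over $\mathbf{C}$ with coproduct $\Delta$ (written $\Delta(a)=a_1\otimes a_2$), counit $\varepsilon$ and invertible antipode $\kappa$. A bicovariant first-order differential calculus $(\Gamma,d)$ is an $A$-bimodule $\Gamma$ and a linear map $d:A\to\Gamma$ with $d(ab)=(da)b+a\,db$, such that every element of $\Gamma$ is a finite sum $\sum_k a_k\,db_k$, and such that the maps $\Delta_\Gamma:\Gamma\to A\otimes\Gamma$, $\Delta_\Gamma(a\,db)=\Delta(a)(id\otimes d)\Delta(b)$, and ${}_\Gamma\Delta:\Gamma\to\Gamma\otimes A$, ${}_\Gamma\Delta(a\,db)=\Delta(a)(d\otimes id)\Delta(b)$, are well defined. The space of left-invariant elements ($\Delta_\Gamma(\omega)=I\otimes\omega$) is assumed to have a finite basis $\{\omega^i\}$; $\Gamma$ is free on it both as left and as right $A$-module. The functionals $f^i{}_j:A\to\mathbf C$, the elements $M_j{}^i\in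 A$ and the functionals $\chi_i:A\to\mathbf C$ are defined by $$\omega^i b=(f^i{}_j*b)\,\omega^j,\qquad {}_\Gamma\Delta(\omega^i)=\omega^j\otimes M_j{}^i,\qquad da=(\chi_i*a)\,\omega^i,$$ where $\psi*a=(id\otimes\psi)\Delta(a)$ for a functional $\psi$. Tensor products of copies of $\Gamma$ are over $A$; $\Gamma^{\otimes 0}=A$. The right coaction on $\Gamma^{\otimes n}$ is ${}_\Gamma\Delta(\rho\otimes\rho'\otimes\cdots)=\rho_1\otimes\rho'_1\otimes\cdots\otimes\rho_2\rho'_2\cdots$, where ${}_\Gamma\Delta(\rho)=\rho_1\otimes\rho_2$; on $\Gamma^{\otimes0}=A$ it is $\Delta$. Exterior forms: set $\Lambda^{ij}{}_{kl}=f^i{}_l(M_k{}^j)$. Wedge products are identified with tensors: $\omega^{i_1}\wedge\cdots\wedge\omega^{i_n}=W^{i_1\ldots i_n}{}_{j_1\ldots j_n}\,\omega^{j_1}\otimes\cdots\otimes\omega^{j_n}$, where as matrices (upper indices = rows, lower indices = columns) $W_1=1$, $W_{1\ldots n}=\mathcal I_{1\ldots n}W_{1\ldots n-1}$, $\mathcal I_{1\ldots n}=1+\sum_{k=1}^{n-1}(-1)^k\Lambda_{n-k,n-k+1}\cdots\Lambda_{n-1,n}$, and $\Lambda_{m,m+1}$ is $\Lambda$ acting on the $m$-th and $(m+1)$-th factors. $\Gamma^{\wedge n}\subset\Gamma^{\otimes n}$ is the left $A$-span of these, $\Gamma^{\wedge}=\bigoplus_n\Gamma^{\wedge n}$ with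 $\Gamma^{\wedge 0}=A$. The differential is extended by $d(a\,db_1\wedge\cdots\wedge db_n)=da\wedge db_1\wedge\cdots\wedge db_n$. Left-invariant vectorfields: $t_i=\chi_i*:A\to A$. Lie derivative: $\ell_{t_i}(\tau)=(id\otimes\chi_i)\,{}_\Gamma\Delta(\tau)$ for $\tau\in\Gamma^{\otimes n}$. Contraction: for $\vartheta=a_{i_n\ldots i_1}\omega^{i_n}\otimes\cdots\otimes\omega^{i_1}$ with $n\geq1$, $i_{t_j}(\vartheta)=(-1)^{n-1}a_{i_n\ldots i_1}\,\omega^{i_n}\otimes\cdots\otimes\omega^{i_2}\,\delta^{i_1}_j$, and $i_{t_j}(a)=0$ for $a\in A$. *)

(* Defs.v *)
From HB Require Import structures.
From mathcomp Require Import all_boot all_order all_algebra.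
From mathcomp Require Import boolp classical_sets reals.
From mathcomp.real_closed Require Export complex.

Set Implicit Arguments.
Unset Strict Implicit.
Unset Printing Implicit Defensive.

Import GRing.Theory.
Local Open Scope ring_scope.

Definition mk_linear (K : pzRingType) (U V : lmodType K) (g : U -> V)
    (hg : linear g) : {linear U -> V} :=
  HB.pack g (GRing.isLinear.Build _ _ _ _ g hg).

(* The tensor product of V and W over a set S of operators, acting K-linearly
   on V by r and on W by l.  It is the commutative monoid of formal sums of
   pairs (lists), modulo the congruence generated by biadditivity and by
   (v s) (x) w = v (x) (s w); since (v, w) + (- v, w) ~ 0 it is a group.
   S = K gives the tensor product over K and S = A that over an algebra A. *)
Section Tensor.
Variables (K : comNzRingType) (S : Type) (V W : lmodType K).
Variables (r : S -> {linear V -> V}) (l : S -> W -> W).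

Inductive tens_eq : seq (V * W) -> seq (V * W) -> Prop :=
| tens_refl s : tens_eq s s
| tens_sym s t : tens_eq s t -> tens_eq t s
| tens_trans s t u : tens_eq s t -> tens_eq t u -> tens_eq s u
| tens_cat s s' t t' :
    tens_eq s s' -> tens_eq t t' -> tens_eq (s ++ t) (s' ++ t')
| tens_comm s t : tens_eq (s ++ t) (t ++ s)
| tens_zero w : tens_eq [:: (0, w)] [::]
| tens_addl v v' w : tens_eq [:: (v + v', w)] [:: (v, w); (v', w)]
| tens_addr v w w' : tens_eq [:: (v, w + w')] [:: (v, w); (v, w')]
| tens_bal a v w : tens_eq [:: (r a v, w)] [:: (v, l a w)].

Definition tens_rel (s t : seq (V * W)) : bool := `[< tens_eq s t >].

Lemma tens_rel_refl : reflexive tens_rel.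
Proof. by move=> s; apply/asboolP; apply: tens_refl. Qed.

Lemma tens_rel_sym : symmetric tens_rel.
Proof. by move=> s t; apply/asboolP/asboolP; apply: tens_sym. Qed.

Lemma tens_rel_trans : transitive tens_rel.
Proof.
by move=> t s u /asboolP st /asboolP tu; apply/asboolP; apply: tens_trans st tu.
Qed.

Canonical tens_equiv := EquivRel tens_rel tens_rel_refl tens_rel_sym tens_rel_trans.

Definition tens : Type := {eq_quot tens_equiv}%qT.
HB.instance Definition _ := Choice.on tens.
HB.instance Definition _ := EqQuotient.on tens.

Definition tsum (s : seq (V * W)) : tens := \pi_tens%qT s.

Lemma tsumP s t : tsum s = tsum t <-> tens_eq s t.
Proof.
split=> [e|e]; first by apply/asboolP/(@eqquotP _ _ tens).
by apply/(@eqquotP _ _ tens)/asboolP.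
Qed.

Lemma tsum_repr (x : tens) : tsum (repr x) = x.
Proof. exact: reprK. Qed.

Definition tens0 : tens := tsum [::].
Definition tens_add (x y : tens) : tens := tsum (repr x ++ repr y).
Definition tens_opp (x : tens) : tens :=
  tsum [seq (- p.1, p.2) | p <- repr x].
Definition tens_scale (k : K) (x : tens) : tens :=
  tsum [seq (k *: p.1, p.2) | p <- repr x].

Lemma tens_eq_map (g : {linear V -> V}) : (forall a v, g (r a v) = r a (g v)) ->
  forall s t, tens_eq s t ->
  tens_eq [seq (g p.1, p.2) | p <- s] [seq (g p.1, p.2) | p <- t].
Proof.
move=> gr s t; elim=> {s t} /=.
- by move=> s; apply: tens_refl.
- by move=> s t _; apply: tens_sym.
- by move=> s t u _ st _; apply: tens_trans.
- by move=> s s' t t' _ ss _ tt; rewrite !map_cat; apply: tens_cat.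
- by move=> s t; rewrite !map_cat; apply: tens_comm.
- by move=> w; rewrite linear0; apply: tens_zero.
- by move=> v v' w; rewrite linearD; apply: tens_addl.
- by move=> v w w'; apply: tens_addr.
- by move=> a v w; rewrite gr; apply: tens_bal.
Qed.

Lemma tsum_cat s t : tsum (s ++ t) = tens_add (tsum s) (tsum t).
Proof. by apply/tsumP/tens_cat; apply/tsumP; rewrite tsum_repr. Qed.

Lemma tens_addC : commutative tens_add.
Proof. by move=> x y; apply/tsumP/tens_comm. Qed.

Lemma tens_addA : associative tens_add.
Proof.
move=> x y z; rewrite -[x]tsum_repr -[y]tsum_repr -[z]tsum_repr.
by rewrite -!tsum_cat catA.
Qed.

Lemma tens_add0 : left_id tens0 tens_add.
Proof. by move=> x; rewrite -[x]tsum_repr -tsum_cat. Qed.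

Lemma tsum_opp s : tens_opp (tsum s) = tsum [seq (- p.1, p.2) | p <- s].
Proof.
apply/tsumP; apply: (@tens_eq_map (mk_linear (g := -%R) _)).
- by move=> k u v; rewrite scalerN opprD.
- by move=> hg a v /=; rewrite linearN.
- by apply/tsumP; rewrite tsum_repr.
Qed.

Lemma tsum_scale k s : tens_scale k (tsum s) = tsum [seq (k *: p.1, p.2) | p <- s].
Proof.
apply/tsumP; apply: (@tens_eq_map (GRing.scale k : {linear V -> V})).
- by move=> a v /=; rewrite linearZ.
- by apply/tsumP; rewrite tsum_repr.
Qed.

Lemma tens_addN : left_inverse tens0 tens_opp tens_add.
Proof.
move=> x; rewrite -[x]tsum_repr; move: (repr x) => s {x}; rewrite tsum_opp.
elim: s => [|[v w] s IH]; first by rewrite -tsum_cat.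
rewrite -[_ :: s]cat1s map_cat !tsum_cat.
set m := tsum [seq _ | p <- s] in IH *; rewrite -tens_addA (tens_addC m).
rewrite -(tens_addA (tsum _) (tsum s)) (tens_addC (tsum s)) IH.
rewrite (tens_addC _ tens0) tens_add0 -tsum_cat.
apply/tsumP; apply: tens_trans (tens_zero w).
by rewrite -(addNr v); apply: tens_sym; apply: tens_addl.
Qed.

HB.instance Definition _ := GRing.isZmodule.Build tens
  tens_addA tens_addC tens_add0 tens_addN.

Lemma tsumD s t : tsum (s ++ t) = tsum s + tsum t.
Proof. exact: tsum_cat. Qed.

Definition tpure (v : V) (w : W) : tens := tsum [:: (v, w)].

Lemma tsumE s : tsum s = \sum_(p <- s) tpure p.1 p.2.
Proof.
elim: s => [|[v w] s IH]; first by rewrite big_nil.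
by rewrite big_cons -cat1s tsumD IH.
Qed.

Lemma tens_ind (x : tens) : exists s : seq (V * W), x = \sum_(p <- s) tpure p.1 p.2.
Proof. by exists (repr x); rewrite -tsumE tsum_repr. Qed.

Lemma tpureDl v v' w : tpure (v + v') w = tpure v w + tpure v' w.
Proof. by rewrite -tsumD; apply/tsumP/tens_addl. Qed.

Lemma tpureDr v w w' : tpure v (w + w') = tpure v w + tpure v w'.
Proof. by rewrite -tsumD; apply/tsumP/tens_addr. Qed.

Lemma tpure_bal a v w : tpure (r a v) w = tpure v (l a w).
Proof. exact/tsumP/tens_bal. Qed.

Lemma tens_scaleA a b (x : tens) :
  tens_scale a (tens_scale b x) = tens_scale (a * b) x.
Proof.
rewrite -[x]tsum_repr !tsum_scale -map_comp.
by congr tsum; apply: eq_map => p /=; rewrite scalerA.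
Qed.

Lemma tens_scale1 : left_id 1 tens_scale.
Proof.
move=> x; rewrite -[x]tsum_repr tsum_scale; congr tsum.
by rewrite -[RHS]map_id; apply: eq_map => -[v w]; rewrite scale1r.
Qed.

Lemma tens_scaleDr : right_distributive tens_scale +%R.
Proof.
move=> k x y; rewrite -[x]tsum_repr -[y]tsum_repr -tsumD !tsum_scale.
by rewrite map_cat tsumD.
Qed.

Lemma tens_scaleDl (x : tens) : {morph tens_scale^~ x : a b / a + b}.
Proof.
move=> a b; rewrite -[x]tsum_repr !tsum_scale !tsumE !big_map -big_split /=.
by apply: eq_bigr => p _; rewrite scalerDl tpureDl.
Qed.

HB.instance Definition _ := GRing.Zmodule_isLmodule.Build K tens
  tens_scaleA tens_scale1 tens_scaleDr tens_scaleDl.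

Lemma tpureZl k v w : tpure (k *: v) w = k *: tpure v w.
Proof. by rewrite [RHS]tsum_scale. Qed.

(* The additive map induced by f : V -> W -> U; it is meaningful when f is
   balanced, see tlift_pure and tliftD. *)
Definition tlift (U : zmodType) (f : V -> W -> U) (x : tens) : U :=
  \sum_(p <- repr x) f p.1 p.2.

Definition balanced (U : zmodType) (f : V -> W -> U) : Prop :=
  [/\ forall v v' w, f (v + v') w = f v w + f v' w,
      forall v w w', f v (w + w') = f v w + f v w' &
      forall a v w, f (r a v) w = f v (l a w)].

Section Lift.
Variables (U : zmodType) (f : V -> W -> U) (hf : balanced f).

Lemma tlift_tsum s : tlift f (tsum s) = \sum_(p <- s) f p.1 p.2.
Proof.
case: hf => fDl fDr fb.
have f0 w : f 0 w = 0.
  by apply: (@addIr _ (f 0 w)); rewrite -fDl addr0 add0r.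
have H s1 s2 : tens_eq s1 s2 ->
    \sum_(p <- s1) f p.1 p.2 = \sum_(p <- s2) f p.1 p.2.
  elim=> {s1 s2} //.
  - by move=> s1 s2 s3 _ -> _ ->.
  - by move=> s1 s2 t1 t2 _ e1 _ e2; rewrite !big_cat e1 e2.
  - by move=> s1 s2; rewrite !big_cat /= addrC.
  - by move=> w; rewrite big_seq1 big_nil.
  - by move=> v v' w; rewrite !big_cons !big_nil /= !addr0.
  - by move=> v w w'; rewrite !big_cons !big_nil /= !addr0.
  - by move=> a v w; rewrite !big_seq1 /= fb.
by apply: H; apply/tsumP; rewrite tsum_repr.
Qed.

Lemma tlift_pure v w : tlift f (tpure v w) = f v w.
Proof. by rewrite tlift_tsum big_seq1. Qed.

Lemma tliftD : {morph tlift f : x y / x + y}.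
Proof.
move=> x y; rewrite -[x]tsum_repr -[y]tsum_repr -tsumD !tlift_tsum.
by rewrite big_cat.
Qed.

End Lift.

Lemma tlift_linear (U : lmodType K) (f : V -> W -> U) : balanced f ->
  (forall k v w, f (k *: v) w = k *: f v w) -> linear (tlift f).
Proof.
move=> hf fZ k x y; rewrite tliftD //; congr (_ + _).
rewrite -[x]tsum_repr [k *: _]tsum_scale !tlift_tsum // big_map scaler_sumr.
by apply: eq_bigr => p _; rewrite fZ.
Qed.

Lemma tens_linear_ext (U : lmodType K) (g h : {linear tens -> U}) :
  (forall v w, g (tpure v w) = h (tpure v w)) -> g =1 h.
Proof.
move=> gh x; have [s ->] := tens_ind x; rewrite !linear_sum.
by apply: eq_bigr => p _; rewrite gh.
Qed.

End Tensor.

Section TensorK.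
Variable K : comNzRingType.

Definition scale_op (V : lmodType K) (k : K) : {linear V -> V} := GRing.scale k.

Definition tensK (V W : lmodType K) : lmodType K :=
  tens (@scale_op V) (fun (k : K) (w : W) => k *: w).

Definition pureK (V W : lmodType K) (v : V) (w : W) : tensK V W := tpure _ _ v w.

Definition liftK (V W : lmodType K) (U : zmodType) (f : V -> W -> U) :
  tensK V W -> U := tlift f.

End TensorK.

Arguments tensK {K} (V W)%_type_scope.
Notation "V ⊗ W" := (tensK V W) (at level 40, left associativity) : type_scope.
Notation "v ⊗ w" := (pureK v w) (at level 40, left associativity) : ring_scope.

Section TensorMaps.
Variable K : comNzRingType.
Implicit Types U V W : lmodType K.

Definition tmap V W V' W' (g : V -> V') (h : W -> W') : V ⊗ W -> V' ⊗ W' :=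
  liftK (fun v w => g v ⊗ h w).

(* (v (x) w, v' (x) w') |-> g v v' (x) h w w' *)
Definition tmap2 V W V' W' V'' W'' (g : V -> V' -> V'') (h : W -> W' -> W'')
    (x : V ⊗ W) (y : V' ⊗ W') : V'' ⊗ W'' :=
  liftK (fun v w => tmap (g v) (h w) y) x.

Definition tassoc U V W : (U ⊗ V) ⊗ W -> U ⊗ (V ⊗ W) :=
  liftK (fun x w => liftK (fun u v => u ⊗ (v ⊗ w)) x).

End TensorMaps.

Record hopf_algebra (K : comNzRingType) (A : algType K) := HopfAlgebra {
  cop :> {linear A -> (A ⊗ A)%type};
  counit : {scalar A};
  antipode : {linear A -> A};
  cop1 : cop 1 = 1 ⊗ 1;
  copM : forall a b, cop (a * b) = tmap2 *%R *%R (cop a) (cop b);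
  counit1 : counit 1 = 1;
  counitM : forall a b, counit (a * b) = counit a * counit b;
  coassoc : forall a, tassoc (tmap cop id (cop a)) = tmap id cop (cop a);
  counitl : forall a, liftK (fun x y => counit x *: y) (cop a) = a;
  counitr : forall a, liftK (fun x y => counit y *: x) (cop a) = a;
  antipodel : forall a,
    liftK (fun x y => antipode x * y) (cop a) = (counit a)%:A;
  antipoder : forall a,
    liftK (fun x y => x * antipode y) (cop a) = (counit a)%:A;
  antipode_bij : bijective antipode }.

Record bimodule (K : comNzRingType) (A : algType K) := Bimodule {
  bimod_sort :> lmodType K;
  lact : A -> {linear bimod_sort -> bimod_sort};
  ract : A -> {linear bimod_sort -> bimod_sort};
  lact_linear : forall v, linear (lact^~ v);
  ract_linear : forall v, linear (ract^~ v);
  lact1 : forall v, lact 1 v = v;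
  ract1 : forall v, ract 1 v = v;
  lactM : forall a b v, lact (a * b) v = lact a (lact b v);
  ractM : forall a b v, ract (a * b) v = ract b (ract a v);
  lract : forall a b v, lact a (ract b v) = ract b (lact a v) }.

Notation "a ⊳ v" := (lact _ a v) (at level 40, left associativity) : ring_scope.
Notation "v ⊲ a" := (ract _ a v) (at level 40, left associativity) : ring_scope.

Section Bimodules.
Variables (K : comNzRingType) (A : algType K).

Fact lmul_linear (a : A) : linear (fun v : A => a * v).
Proof. by move=> k u v; rewrite mulrDr scalerAr. Qed.

Fact rmul_linear (a : A) : linear (fun v : A => v * a).
Proof. by move=> k u v; rewrite mulrDl scalerAl. Qed.

Definition regular_bimodule : bimodule A.
Proof.
apply: (@Bimodule K A A (fun a => mk_linear (lmul_linear a))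
                        (fun a => mk_linear (rmul_linear a))) => /=.
- exact: rmul_linear.
- exact: lmul_linear.
- exact: mul1r.
- exact: mulr1.
- by move=> a b v; rewrite mulrA.
- by move=> a b v; rewrite mulrA.
- by move=> a b v; rewrite mulrA.
Defined.

Variables P Q : bimodule A.

Definition tensA : lmodType K :=
  tens (fun a => ract P a) (fun (a : A) (q : Q) => lact Q a q).

Definition pureA (p : P) (q : Q) : tensA := tpure _ _ p q.

Definition liftA (U : zmodType) (g : P -> Q -> U) : tensA -> U := tlift g.

Definition tensA_lact (a : A) : tensA -> tensA := liftA (fun p q => pureA (a ⊳ p) q).
Definition tensA_ract (a : A) : tensA -> tensA := liftA (fun p q => pureA p (q ⊲ a)).

Fact tensA_lact_linear a : linear (tensA_lact a).
Proof.
apply: tlift_linear => [|k p q]; last by rewrite /pureA linearZ tpureZl.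
split=> [p p' q|p q q'|b p q]; rewrite /pureA.
- by rewrite linearD tpureDl.
- by rewrite tpureDr.
- by rewrite lract tpure_bal.
Qed.

Fact tensA_ract_linear a : linear (tensA_ract a).
Proof.
apply: tlift_linear => [|k p q]; last by rewrite /pureA tpureZl.
split=> [p p' q|p q q'|b p q]; rewrite /pureA.
- by rewrite tpureDl.
- by rewrite linearD tpureDr.
- by rewrite -lract tpure_bal.
Qed.

Lemma tensA_lact_pure a p q : tensA_lact a (pureA p q) = pureA (a ⊳ p) q.
Proof.
apply: tlift_pure; split=> [p1 p2 q1|p1 q1 q2|b p1 q1]; rewrite /pureA.
- by rewrite linearD tpureDl.
- by rewrite tpureDr.
- by rewrite lract tpure_bal.
Qed.

Lemma tensA_ract_pure a p q : tensA_ract a (pureA p q) = pureA p (q ⊲ a).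
Proof.
apply: tlift_pure; split=> [p1 p2 q1|p1 q1 q2|b p1 q1]; rewrite /pureA.
- by rewrite tpureDl.
- by rewrite linearD tpureDr.
- by rewrite -lract tpure_bal.
Qed.

Lemma lactZl (R : bimodule A) k a (v : R) : (k *: a) ⊳ v = k *: (a ⊳ v).
Proof. exact: (linearZ_LR (mk_linear (lact_linear v))). Qed.

Lemma ractZl (R : bimodule A) k a (v : R) : v ⊲ (k *: a) = k *: (v ⊲ a).
Proof. exact: (linearZ_LR (mk_linear (ract_linear v))). Qed.

Lemma pureAZr k p q : pureA p (k *: q) = k *: pureA p q.
Proof.
rewrite /pureA -tpureZl -[q in LHS](lact1 q) -lactZl -tpure_bal.
by rewrite ractZl ract1.
Qed.

Let L a := mk_linear (tensA_lact_linear a).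
Let R a := mk_linear (tensA_ract_linear a).

Let Lp a p q : L a (tpure _ _ p q) = pureA (a ⊳ p) q.
Proof. exact: tensA_lact_pure. Qed.

Let Rp a p q : R a (tpure _ _ p q) = pureA p (q ⊲ a).
Proof. exact: tensA_ract_pure. Qed.

Fact tensA_lact_linearl x : linear (L^~ x).
Proof.
move=> k a b; have [s ->] := tens_ind x.
rewrite !(linear_sum (L _)) scaler_sumr -big_split; apply: eq_bigr => -[p q] _.
by rewrite !Lp lact_linear /pureA tpureDl tpureZl.
Qed.

Fact tensA_ract_linearl x : linear (R^~ x).
Proof.
move=> k a b; have [s ->] := tens_ind x.
rewrite !(linear_sum (R _)) scaler_sumr -big_split; apply: eq_bigr => -[p q] _.
by rewrite !Rp ract_linear -pureAZr; exact: tpureDr.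
Qed.

Fact tensA_lact1 x : L 1 x = x.
Proof.
apply: (@tens_linear_ext _ _ _ _ _ _ _ (L 1) idfun) => p q.
by rewrite Lp lact1.
Qed.

Fact tensA_ract1 x : R 1 x = x.
Proof.
apply: (@tens_linear_ext _ _ _ _ _ _ _ (R 1) idfun) => p q.
by rewrite Rp ract1.
Qed.

Fact tensA_lactM a b x : L (a * b) x = L a (L b x).
Proof.
apply: (tens_linear_ext (g := L _) (h := L a \o L b)) => p q.
by rewrite -[RHS]/(L a (L b _)) !Lp lactM.
Qed.

Fact tensA_ractM a b x : R (a * b) x = R b (R a x).
Proof.
apply: (tens_linear_ext (g := R _) (h := R b \o R a)) => p q.
by rewrite -[RHS]/(R b (R a _)) !Rp ractM.
Qed.

Fact tensA_lract a b x : L a (R b x) = R b (L a x).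
Proof.
apply: (tens_linear_ext (g := L a \o R b) (h := R b \o L a)) => p q.
by rewrite -[LHS]/(L a (R b _)) -[RHS]/(R b (L a _)) Lp !Rp Lp.
Qed.

Definition tensA_bimodule : bimodule A :=
  Bimodule tensA_lact_linearl tensA_ract_linearl tensA_lact1 tensA_ract1
    tensA_lactM tensA_ractM tensA_lract.

End Bimodules.

(* Gamma^(x)0 = A and Gamma^(x)(n+1) = Gamma^(x)n (x)_A Gamma; in particular
   a one-form rho is the tensor 1 (x) rho of A (x)_A Gamma. *)
Fixpoint tpow (K : comNzRingType) (A : algType K) (G : bimodule A) (n : nat) :
    bimodule A :=
  if n is m.+1 then tensA_bimodule (tpow G m) G else regular_bimodule A.

(* coLE and coRE say that Delta_Gamma and _Gamma Delta are well defined. *)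
Record bicovariant_calculus (K : comNzRingType) (A : algType K)
    (H : hopf_algebra A) := BicovariantCalculus {
  forms1 :> bimodule A;
  dif : {linear A -> forms1};
  difM : forall a b, dif (a * b) = dif a ⊲ b + a ⊳ dif b;
  dif_span : forall rho : forms1,
    exists s : seq (A * A), rho = \sum_(p <- s) (p.1 ⊳ dif p.2);
  coL : {linear forms1 -> (A ⊗ forms1)%type};
  coLE : forall a b,
    coL (a ⊳ dif b) =
    tmap2 *%R (fun x (rho : forms1) => x ⊳ rho) (H a) (tmap id dif (H b));
  coR : {linear forms1 -> (forms1 ⊗ A)%type};
  coRE : forall a b,
    coR (a ⊳ dif b) =
    tmap2 (fun x (rho : forms1) => x ⊳ rho) *%R (H a) (tmap dif id (H b)) }.

(* The convolution psi * a = (id (x) psi) Delta(a) *)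
Definition conv (K : comNzRingType) (A : algType K) (H : hopf_algebra A)
    (psi : {scalar A}) (a : A) : A :=
  liftK (fun x y => psi y *: x) (H a).

(* A finite basis omega of the left-invariant forms and the associated f, M,
   chi: sf f i j is f^i_j, sM k j is M_k^j (lower index first). *)
Record invariant_frame (K : comNzRingType) (A : algType K)
    (H : hopf_algebra A) (G : bicovariant_calculus H) := InvariantFrame {
  fdim : nat;
  omega : 'I_fdim -> G;
  omega_inv : forall i, coL G (omega i) = 1 ⊗ omega i;
  omega_basis : forall rho : G, coL G rho = 1 ⊗ rho ->
    exists! c : {ffun 'I_fdim -> K}, rho = \sum_i c i *: omega i;
  omega_lfree : forall rho : G,
    exists! c : {ffun 'I_fdim -> A}, rho = \sum_i (c i ⊳ omega i);
  omega_rfree : forall rho : G,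
    exists! c : {ffun 'I_fdim -> A}, rho = \sum_i (omega i ⊲ c i);
  sf : 'I_fdim -> 'I_fdim -> {scalar A};
  sfE : forall i b, omega i ⊲ b = \sum_j (conv H (sf i j) b ⊳ omega j);
  sM : 'I_fdim -> 'I_fdim -> A;
  sME : forall i, coR G (omega i) = \sum_j omega j ⊗ sM j i;
  chi : 'I_fdim -> {scalar A};
  chiE : forall a, dif G a = \sum_i (conv H (chi i) a ⊳ omega i) }.

Arguments omega {K A H G} _.
Arguments sf {K A H G} _.
Arguments sM {K A H G} _.
Arguments chi {K A H G} _.

Section Cartan.
Variables (K : comNzRingType) (A : algType K) (H : hopf_algebra A).
Variables (G : bicovariant_calculus H) (F : invariant_frame G).

Local Notation N := (fdim F).
Local Notation T := (tpow G).
Local Notation midx n := {ffun 'I_n -> 'I_N}.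

(* Families indexed by 0, ..., n: all but the last, last, and adjoining a head *)
Definition front X n (g : 'I_n.+1 -> X) (k : 'I_n) : X :=
  g (widen_ord (leqnSn n) k).
Definition fcons X n (x : X) (g : 'I_n -> X) (k : 'I_n.+1) : X :=
  oapp g x (unlift ord0 k).

(* rho_0 (x) ... (x) rho_(n-1) *)
Fixpoint ptens n : ('I_n -> G) -> T n :=
  if n is m.+1 then fun rho => pureA (ptens (front rho)) (rho ord_max)
  else fun _ => (1 : A).

Definition otens n (I : 'I_n -> 'I_N) : T n := ptens (fun k => omega F (I k)).

(* The right coaction; the map being lifted is A-balanced because
   coR (rho a) = coR rho Delta(a) and coR (a rho) = Delta(a) coR rho. *)
Fixpoint coRn n : T n -> T n ⊗ A :=
  if n is m.+1 then
    liftA (fun (theta : T m) (rho : G) =>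
             tmap2 (@pureA _ _ (T m) G) *%R (coRn theta) (coR G rho))
  else H.

(* The coefficients a_I of theta = a_I omega^I, unique since the omega^I are a
   left A-basis *)
Definition coef n (theta : T n) : {ffun midx n -> A} :=
  xget 0 [set c : {ffun midx n -> A} |
            theta = \sum_(I : midx n) (c I ⊳ otens I)]%classic.

(* Rows are upper multi-indices, columns lower ones. *)
Local Notation mmx n := 'M[K]_(#|{: midx n}|).
Definition mmatrix n (E : midx n -> midx n -> K) : mmx n :=
  \matrix_(p, q) E (enum_val p) (enum_val q).
Definition mentry n (X : mmx n) (I J : midx n) : K :=
  X (enum_rank I) (enum_rank J).

Definition Lambda (i j k l : 'I_N) : K := sf F i l (sM F k j).

(* Lambda_{m,m+1} for 1 <= m <= n, acting on n+1 factors numbered from 1 *)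
Definition Lambda_at n (m : nat) : mmx n.+1 :=
  let p : 'I_n.+1 := inord m.-1 in
  let q : 'I_n.+1 := inord m in
  mmatrix (fun I J => Lambda (I p) (I q) (J p) (J q) *
                      \prod_(r | (r != p) && (r != q)) (I r == J r)%:R).

(* I_{1...n+1} *)
Definition shuffle n : mmx n.+1 :=
  1 + \sum_(1 <= k < n.+1)
        (-1) ^+ k *: \prod_(n.+1 - k <= m < n.+1) Lambda_at n m.

(* W_{1...n}; in the step W_{1...n} acts on the first n of the n+1 factors *)
Fixpoint W n : mmx n :=
  if n is m.+1 then
    shuffle m *m
    mmatrix (fun I J => mentry (W m) [ffun k => front I k] [ffun k => front J k]
                        * (I ord_max == J ord_max)%:R)
  else 1.

(* The left A-linear map omega^I |-> W^I_J omega^J, which identifies wedge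
   products with tensors: since Gamma^/\ is a quotient of the tensor algebra,
   it sends rho_1 (x) ... (x) rho_n to rho_1 /\ ... /\ rho_n for all one-forms,
   their coefficients being first moved to the left. *)
Definition antisym n (theta : T n) : T n :=
  \sum_(I : midx n) \sum_(J : midx n)
    mentry (W n) I J *: (coef theta I ⊳ otens J).

(* rho_0 /\ ... /\ rho_(n-1) *)
Definition wedge n (rho : 'I_n -> G) : T n := antisym (ptens rho).

Definition owedge n (I : 'I_n -> 'I_N) : T n := wedge (fun k => omega F (I k)).

Definition is_form n (theta : T n) : Prop :=
  exists c : {ffun midx n -> A}, theta = \sum_(I : midx n) (c I ⊳ owedge I).

(* \sum_k a_k db_1 /\ ... /\ db_n and its differential *)
Definition drep n (s : seq (A * {ffun 'I_n -> A})) : T n :=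
  \sum_(p <- s) (p.1 ⊳ wedge (fun k => dif G (p.2 k))).
Definition drep_d n (s : seq (A * {ffun 'I_n -> A})) : T n.+1 :=
  \sum_(p <- s) wedge (fcons (dif G p.1) (fun k => dif G (p.2 k))).

(* The differential of theta, computed from a chosen representation
   theta = \sum_k a_k db_1 /\ ... /\ db_n; that d is well defined means that the
   choice is irrelevant. *)
Definition extd n (theta : T n) : T n.+1 :=
  drep_d (xget [::] [set s | theta = drep s]%classic).

Definition lie (i : 'I_N) n (theta : T n) : T n :=
  liftK (fun (eta : T n) (a : A) => chi F i a *: eta) (coRn theta).

(* i_{t_j} on degree n+1, where (-1)^(n+1-1) = (-1)^n *)
Definition contract (j : 'I_N) n (theta : T n.+1) : T n :=
  (-1) ^+ n *: \sum_(I : midx n.+1 | I ord_max == j) (coef theta I ⊳ otens (front I)).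

(* d o i_{t_j}, which is 0 on degree 0 as i_{t_j} vanishes there *)
Definition extd_contract (j : 'I_N) n : T n -> T n :=
  if n is m.+1 then fun theta => extd (contract j theta) else fun _ => 0.

End Cartan.

(* Main.v *)
From HB Require Import structures.
Require Import Defs.
From mathcomp Require Import all_boot all_order all_algebra.
From mathcomp Require Import boolp classical_sets reals.

Set Implicit Arguments.
Unset Strict Implicit.
Unset Printing Implicit Defensive.

Import GRing.Theory.
Local Open Scope ring_scope.

(** Identify a tensor by its left coefficients on the basis of invariant forms.
    The recursion I_(1...n+1) = 1 - I_(1...n) Lambda_(n,n+1) for the shuffle
    matrices says that a tensor x of degree n+1 satisfies
      antisym x = sum_l antisym (D_l x) (x) omega^l                    (1)
    for operators D_l that obey the twisted Leibniz rule
      D_l (x (x) db) = x (chi_l * b) - sum_i D_i x (x) d (f^i_l * b)   (2)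
    (antisym_rec, sder_snoc_dif).  By (1), up to the sign (-1)^n, the
    contraction with t_l of the exterior form of x is the form of D_l x, so a
    form vanishes as soon as all its contractions vanish.

    On tensors a db_1 (x) ... (x) db_n, before antisymmetrization, d is the
    formal operation that replaces a by da; it satisfies
    d (x c) = (dx) c + (-1)^n x (x) dc (diff_ract).  The coproduct of chi_l
    gives
      l_(t_l) (x (x) db) = sum_k l_(t_k) x (x) d (f^k_l * b)
                           + x (x) d (chi_l * b)                       (3)
    (chi_coact).  From (2) and (3) the Cartan formula holds for these formal
    expressions, without any quotient, by induction on the number of factors:
    the terms in (dx) (chi_l * b) cancel (cartan_tensor).

    It remains to see that the formal d induces d on forms, i.e. that it maps
    expressions of the zero form to expressions of the zero form.  The right
    coaction commutes with the operators D_l, up to the matrix M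
    (sder_coact, a consequence of the Yetter-Drinfeld relation between f and
    M), hence with antisym (coact_antisym); thus Lie derivatives preserve the
    kernel of antisym.  If x has zero form, so have D_l x and, by induction on
    the degree, its formal differential; the Cartan formula then shows that
    all contractions of dx vanish as forms, hence so does dx
    (diff_antisym0). *)

(** * Tensor products over the ground ring *)

Section Bilinear.
Variable K : comNzRingType.
Implicit Types U V W : lmodType K.

(** Maps that are linear in each argument; unlike a packed structure, this can
    be used for the raw functions from which tensor maps are lifted. *)
Definition bilin U V W (f : U -> V -> W) : Prop :=
  (forall u, linear (f u)) /\ (forall v, linear (f^~ v)).

Section Rules.
Variables (U V W : lmodType K) (f : U -> V -> W) (hf : bilin f).

Lemma bilinDl u u' v : f (u + u') v = f u v + f u' v.
Proof. exact: (linearD (mk_linear (hf.2 v))). Qed.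
Lemma bilinDr u v v' : f u (v + v') = f u v + f u v'.
Proof. exact: (linearD (mk_linear (hf.1 u))). Qed.
Lemma bilinZl k u v : f (k *: u) v = k *: f u v.
Proof. exact: (linearZ_LR (mk_linear (hf.2 v))). Qed.
Lemma bilinZr k u v : f u (k *: v) = k *: f u v.
Proof. exact: (linearZ_LR (mk_linear (hf.1 u))). Qed.
Lemma bilin0l v : f 0 v = 0.
Proof. exact: (linear0 (mk_linear (hf.2 v))). Qed.
Lemma bilin0r u : f u 0 = 0.
Proof. exact: (linear0 (mk_linear (hf.1 u))). Qed.
Lemma bilinNl u v : f (- u) v = - f u v.
Proof. exact: (linearN (mk_linear (hf.2 v))). Qed.
Lemma bilinNr u v : f u (- v) = - f u v.
Proof. exact: (linearN (mk_linear (hf.1 u))). Qed.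
Lemma bilin_suml I (r : seq I) (P : pred I) F v :
  f (\sum_(i <- r | P i) F i) v = \sum_(i <- r | P i) f (F i) v.
Proof. exact: (linear_sum (mk_linear (hf.2 v))). Qed.
Lemma bilin_sumr I (r : seq I) (P : pred I) F u :
  f u (\sum_(i <- r | P i) F i) = \sum_(i <- r | P i) f u (F i).
Proof. exact: (linear_sum (mk_linear (hf.1 u))). Qed.

End Rules.

Lemma bilin_pureK U V : bilin (@pureK K U V).
Proof.
split=> [u k v v'|v k u u'].
  by rewrite [LHS]tpureDr -[in LHS]tpure_bal [in LHS]tpureZl.
by rewrite [LHS]tpureDl [in LHS]tpureZl.
Qed.

Lemma bilin_mul (A : algType K) : bilin (@GRing.mul A).
Proof.
split=> [u k v v'|v k u u']; first by rewrite mulrDr scalerAr.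
by rewrite mulrDl scalerAl.
Qed.

Lemma tensK_ind U V (P : U ⊗ V -> Prop) :
  P 0 -> (forall x y, P x -> P y -> P (x + y)) -> (forall u v, P (u ⊗ v)) ->
  forall x, P x.
Proof.
move=> P0 PD Pp x; have [s ->] := tens_ind x.
by elim/big_rec: _ => // p y _; apply: PD; apply: Pp.
Qed.

Lemma bilin_balanced U V W (f : U -> V -> W) : bilin f ->
  balanced (@scale_op K U) (fun (k : K) (v : V) => k *: v) f.
Proof.
move=> hf; split=> *; first exact: bilinDl.
  exact: bilinDr.
by rewrite /scale_op /= (bilinZl hf) (bilinZr hf).
Qed.

Lemma liftK_pure U V W (f : U -> V -> W) u v : bilin f ->
  Defs.liftK f (u ⊗ v) = f u v.
Proof. by move=> hf; apply: tlift_pure; apply: bilin_balanced. Qed.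

Lemma liftK_linear U V W (f : U -> V -> W) : bilin f -> linear (Defs.liftK f).
Proof.
move=> hf; apply: tlift_linear; first exact: bilin_balanced.
by move=> *; rewrite (bilinZl hf).
Qed.

Section LinearTools.
Variables U V W : lmodType K.

Lemma linear_comp (g : V -> W) (h : U -> V) :
  linear g -> linear h -> linear (g \o h).
Proof. by move=> hg hh k u v; rewrite /= hh hg. Qed.

Lemma linearDE (g : U -> V) x y : linear g -> g (x + y) = g x + g y.
Proof. by move=> hg; apply: (linearD (mk_linear hg)). Qed.

Lemma linearZE (g : U -> V) k x : linear g -> g (k *: x) = k *: g x.
Proof. by move=> hg; apply: (linearZ_LR (mk_linear hg)). Qed.

Lemma linear0E (g : U -> V) : linear g -> g 0 = 0.
Proof. by move=> hg; apply: (linear0 (mk_linear hg)). Qed.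

Lemma linear_sumE (g : U -> V) I (r : seq I) (P : pred I) F : linear g ->
  g (\sum_(i <- r | P i) F i) = \sum_(i <- r | P i) g (F i).
Proof. by move=> hg; apply: (linear_sum (mk_linear hg)). Qed.

End LinearTools.

Lemma tensK_ext U V W (g h : U ⊗ V -> W) : linear g -> linear h ->
  (forall u v, g (u ⊗ v) = h (u ⊗ v)) -> g =1 h.
Proof.
move=> hg hh e; elim/tensK_ind => [|x y ex ey|//].
  by rewrite (linear0E hg) (linear0E hh).
by rewrite (linearDE _ _ hg) (linearDE _ _ hh) ex ey.
Qed.

Section TMap.
Variables (V W V' W' : lmodType K) (g : V -> V') (h : W -> W').
Hypotheses (hg : linear g) (hh : linear h).

Lemma bilin_tmap : bilin (fun v w => g v ⊗ h w).
Proof.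
split=> [v k w w'|w k v v'] /=.
  by rewrite hh (bilinDr (@bilin_pureK _ _)) (bilinZr (@bilin_pureK _ _)).
by rewrite hg (bilinDl (@bilin_pureK _ _)) (bilinZl (@bilin_pureK _ _)).
Qed.

Lemma tmap_pure v w : tmap g h (v ⊗ w) = g v ⊗ h w.
Proof. by rewrite /tmap (liftK_pure _ _ bilin_tmap). Qed.

Lemma tmap_linear : linear (tmap g h).
Proof. exact: (liftK_linear bilin_tmap). Qed.

End TMap.

Section TMap2.
Variables (V V' V'' W W' W'' : lmodType K).
Variables (g : V -> V' -> V'') (h : W -> W' -> W'').
Hypotheses (hg : bilin g) (hh : bilin h).

Lemma bilin_tmap2_aux y : bilin (fun v w => tmap (g v) (h w) y).
Proof.
split=> [v k w w'|w k v v'] /=.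
  elim/tensK_ind: y => [|y y' ey ey'|u u'].
  - by rewrite !(linear0E (tmap_linear (hg.1 _) (hh.1 _))) scaler0 addr0.
  - rewrite !(linearDE _ _ (tmap_linear (hg.1 _) (hh.1 _))) scalerDr.
    by rewrite ey ey' addrACA.
  - rewrite !(tmap_pure (hg.1 _) (hh.1 _)) (bilinDl hh) (bilinZl hh).
    by rewrite (bilinDr (@bilin_pureK _ _)) (bilinZr (@bilin_pureK _ _)).
elim/tensK_ind: y => [|y y' ey ey'|u u'].
- by rewrite !(linear0E (tmap_linear (hg.1 _) (hh.1 _))) scaler0 addr0.
- rewrite !(linearDE _ _ (tmap_linear (hg.1 _) (hh.1 _))) scalerDr.
  by rewrite ey ey' addrACA.
- rewrite !(tmap_pure (hg.1 _) (hh.1 _)) (bilinDl hg) (bilinZl hg).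
  by rewrite (bilinDl (@bilin_pureK _ _)) (bilinZl (@bilin_pureK _ _)).
Qed.

Lemma tmap2_purel v w y : tmap2 g h (v ⊗ w) y = tmap (g v) (h w) y.
Proof. by rewrite /tmap2 (liftK_pure _ _ (bilin_tmap2_aux y)). Qed.

Lemma tmap2_pure v w v' w' : tmap2 g h (v ⊗ w) (v' ⊗ w') = g v v' ⊗ h w w'.
Proof. by rewrite tmap2_purel (tmap_pure (hg.1 _) (hh.1 _)). Qed.

Lemma bilin_tmap2 : bilin (tmap2 g h).
Proof.
split; last by move=> y; apply: (liftK_linear (bilin_tmap2_aux y)).
move=> x k y y'; have L z : linear (fun x => tmap2 g h x z).
  exact: (liftK_linear (bilin_tmap2_aux z)).
elim/tensK_ind: x => [|x x' ex ex'|v w].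
- by rewrite !(linear0E (L _)) scaler0 addr0.
- by rewrite !(linearDE _ _ (L _)) ex ex' scalerDr addrACA.
- by rewrite !tmap2_purel (tmap_linear (hg.1 _) (hh.1 _)).
Qed.

End TMap2.

(** Associativity of componentwise products of tensors, for possibly different
    products of the components: it covers the coproduct, both actions and the
    tensor products of forms. *)
Lemma tmap2A U1 U2 U3 U12 U23 U W1 W2 W3 W12 W23 W
    (g1 : U12 -> U3 -> U) (g2 : U1 -> U2 -> U12)
    (g3 : U1 -> U23 -> U) (g4 : U2 -> U3 -> U23)
    (h1 : W12 -> W3 -> W) (h2 : W1 -> W2 -> W12)
    (h3 : W1 -> W23 -> W) (h4 : W2 -> W3 -> W23) :
  bilin g1 -> bilin g2 -> bilin g3 -> bilin g4 ->
  bilin h1 -> bilin h2 -> bilin h3 -> bilin h4 ->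
  (forall a b c, g1 (g2 a b) c = g3 a (g4 b c)) ->
  (forall a b c, h1 (h2 a b) c = h3 a (h4 b c)) ->
  forall x y z,
  tmap2 g1 h1 (tmap2 g2 h2 x y) z = tmap2 g3 h3 x (tmap2 g4 h4 y z).
Proof.
move=> G1 G2 G3 G4 H1 H2 H3 H4 eg eh x y z.
have B1 := bilin_tmap2 G1 H1; have B2 := bilin_tmap2 G2 H2.
have B3 := bilin_tmap2 G3 H3; have B4 := bilin_tmap2 G4 H4.
elim/tensK_ind: x => [|x x' ex ex'|u1 w1].
- by rewrite (bilin0l B2) (bilin0l B1) (bilin0l B3).
- by rewrite (bilinDl B2) (bilinDl B1) (bilinDl B3) ex ex'.
elim/tensK_ind: y => [|x x' ex ex'|u2 w2].
- by rewrite (bilin0r B2) (bilin0l B1) (bilin0l B4) (bilin0r B3).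
- by rewrite (bilinDr B2) (bilinDl B1) (bilinDl B4) (bilinDr B3) ex ex'.
elim/tensK_ind: z => [|x x' ex ex'|u3 w3].
- by rewrite (bilin0r B1) (bilin0r B4) (bilin0r B3).
- by rewrite (bilinDr B1) (bilinDr B4) (bilinDr B3) ex ex'.
by rewrite !tmap2_pure // eg eh.
Qed.

(** ** Slices *)

Section Slices.
Variables (V W : lmodType K).

(** Application of a functional to the second, resp. the first, factor. *)
Definition slice (psi : W -> K) : V ⊗ W -> V :=
  Defs.liftK (fun v w => psi w *: v).
Definition lslice (phi : V -> K) : V ⊗ W -> W :=
  Defs.liftK (fun v w => phi v *: w).

Lemma bilin_slice (psi : {scalar W}) : bilin (fun (v : V) w => psi w *: v).
Proof.
split=> [v k w w'|w k v v'] /=.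
  by rewrite linearP scalerDl scalerA.
by rewrite scalerDr !scalerA mulrC.
Qed.

Lemma bilin_lslice (phi : {scalar V}) : bilin (fun v (w : W) => phi v *: w).
Proof.
split=> [v k w w'|w k v v'] /=.
  by rewrite scalerDr !scalerA mulrC.
by rewrite linearP scalerDl scalerA.
Qed.

Lemma slice_linear (psi : {scalar W}) : linear (slice psi).
Proof. exact: (liftK_linear (bilin_slice psi)). Qed.
Lemma lslice_linear (phi : {scalar V}) : linear (lslice phi).
Proof. exact: (liftK_linear (bilin_lslice phi)). Qed.

HB.instance Definition _ (psi : {scalar W}) :=
  GRing.isLinear.Build K _ _ _ (slice psi) (slice_linear psi).
HB.instance Definition _ (phi : {scalar V}) :=
  GRing.isLinear.Build K _ _ _ (lslice phi) (lslice_linear phi).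

Lemma slice_pure (psi : {scalar W}) v w : slice psi (v ⊗ w) = psi w *: v.
Proof. exact: (liftK_pure _ _ (bilin_slice psi)). Qed.
Lemma lslice_pure (phi : {scalar V}) v w : lslice phi (v ⊗ w) = phi v *: w.
Proof. exact: (liftK_pure _ _ (bilin_lslice phi)). Qed.

Lemma eq_slice (psi psi' : W -> K) : psi =1 psi' -> slice psi =1 slice psi'.
Proof. by move=> e x; apply: eq_bigr => p _; rewrite e. Qed.

End Slices.

Lemma slice_tmapl V V' W (g : {linear V -> V'}) (psi : {scalar W}) x :
  slice psi (tmap g id x) = g (slice psi x).
Proof.
have lg : linear g by apply: linearP.
have li : linear (@id W) by [].
move: x; apply: tensK_ext.
- exact: (linear_comp (slice_linear _) (tmap_linear lg li)).
- exact: (linear_comp lg (slice_linear _)).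
by move=> u v; rewrite (tmap_pure lg li) !slice_pure linearZ.
Qed.

Lemma lslice_tmapl V V' W (g : {linear V -> V'}) (phi : {scalar V'})
    (phi' : {scalar V}) x : phi \o g =1 phi' ->
  lslice phi (tmap g (@id W) x) = lslice phi' x.
Proof.
move=> e; have lg : linear g by apply: linearP.
have li : linear (@id W) by [].
move: x; apply: tensK_ext.
- exact: (linear_comp (lslice_linear _) (tmap_linear lg li)).
- exact: lslice_linear.
by move=> u v; rewrite (tmap_pure lg li) !lslice_pure -e.
Qed.

End Bilinear.

Section RightTranslate.
Variables (K : comNzRingType) (A : algType K).

(** The functional x |-> psi (x a). *)
Definition rtrans (psi : A -> K) (a : A) (x : A) : K := psi (x * a).

Fact rtrans_scalar (psi : {scalar A}) a : scalar (rtrans psi a).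
Proof. by move=> k x y; rewrite /rtrans mulrDl -scalerAl linearP. Qed.

HB.instance Definition _ (psi : {scalar A}) a :=
  GRing.isLinear.Build K _ _ _ (rtrans psi a) (rtrans_scalar psi a).

Lemma slice_rtrans_linear (V : lmodType K) (psi : {scalar A}) (x : V ⊗ A) :
  linear (fun a => slice (rtrans psi a) x).
Proof.
move=> k a b; rewrite /slice /Defs.liftK /tlift scaler_sumr -big_split.
apply: eq_bigr => p _ /=.
by rewrite /rtrans mulrDr -scalerAr linearP scalerDl scalerA.
Qed.

Lemma slice_tmap2r (U V W : lmodType K) (g : U -> V -> W)
    (psi : {scalar A}) x v a :
  bilin g ->
  slice psi (tmap2 g *%R x (v ⊗ a)) = g (slice (rtrans psi a) x) v.
Proof.
move=> hg; have B := bilin_tmap2 hg (@bilin_mul K A).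
move: x; apply: tensK_ext.
- exact: (linear_comp (slice_linear _) (B.2 _)).
- exact: (linear_comp (hg.2 v) (slice_linear _)).
move=> u b; rewrite (tmap2_pure hg (@bilin_mul K A)) !slice_pure.
by rewrite (bilinZl hg).
Qed.

(** The slice of a product by a functional whose coproduct is
    sum_i phi_i (x) theta_i. *)
Lemma slice_tmap2 (U V W : lmodType K) (g : U -> V -> W) (psi : {scalar A})
    I (r : seq I) (phi theta : I -> {scalar A}) x y : bilin g ->
  (forall a b, psi (a * b) = \sum_(i <- r) phi i a * theta i b) ->
  slice psi (tmap2 g *%R x y) =
  \sum_(i <- r) g (slice (phi i) x) (slice (theta i) y).
Proof.
move=> hg e; have B := bilin_tmap2 hg (@bilin_mul K A).
elim/tensK_ind: x => [|x x' ex ex'|u a].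
- rewrite (bilin0l B) linear0 big1 // => i _.
  by rewrite linear0 (bilin0l hg).
- rewrite (bilinDl B) linearD /= ex ex' -big_split; apply: eq_bigr => i _ /=.
  by rewrite linearD (bilinDl hg).
elim/tensK_ind: y => [|x x' ex ex'|v b].
- rewrite (bilin0r B) linear0 big1 // => i _.
  by rewrite linear0 (bilin0r hg).
- rewrite (bilinDr B) linearD /= ex ex' -big_split; apply: eq_bigr => i _ /=.
  by rewrite linearD (bilinDr hg).
rewrite (tmap2_pure hg (@bilin_mul K A)) slice_pure e scaler_suml.
apply: eq_bigr => i _.
by rewrite !slice_pure (bilinZl hg) (bilinZr hg) scalerA.
Qed.

End RightTranslate.

(** * Bimodules and tensor powers *)

Section BimoduleTheory.
Variables (K : comNzRingType) (A : algType K).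

Lemma bilin_lact (P : bimodule A) : bilin (fun (a : A) (v : P) => a ⊳ v).
Proof. by split=> [a|v]; [apply: linearP | apply: lact_linear]. Qed.

Lemma bilin_ract (P : bimodule A) : bilin (fun (v : P) (a : A) => v ⊲ a).
Proof. by split=> [v|a]; [apply: ract_linear | apply: linearP]. Qed.

Section Tensors.
Variables (P Q : bimodule A).
Local Notation PQ := (tensA_bimodule P Q).

(** The pure tensor [p (x)_A q], with the bimodule of tensors as its type. *)
Definition pureB (p : P) (q : Q) : PQ := pureA p q.

Lemma bilin_pureB : bilin pureB.
Proof.
split=> [p k q q'|q k p p'].
  by rewrite /pureB [LHS]tpureDr -/(pureA _ _) pureAZr.
by rewrite /pureB [LHS]tpureDl -/(pureA _ _) /pureA tpureZl.
Qed.

Lemma pureB_bal p a q : pureB (p ⊲ a) q = pureB p (a ⊳ q).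
Proof. exact: tpure_bal. Qed.

Lemma lact_pureB a p q : a ⊳ pureB p q = pureB (a ⊳ p) q.
Proof. exact: tensA_lact_pure. Qed.

Lemma ract_pureB a p q : pureB p q ⊲ a = pureB p (q ⊲ a).
Proof. exact: tensA_ract_pure. Qed.

Lemma pureB_ind (C : PQ -> Prop) :
  C 0 -> (forall x y, C x -> C y -> C (x + y)) -> (forall p q, C (pureB p q)) ->
  forall x, C x.
Proof.
move=> P0 PD Pp x; have [s ->] := tens_ind (x : tensA P Q).
by elim/big_rec: _ => // p y _; apply: PD; apply: Pp.
Qed.

Lemma pureB_ext (W : lmodType K) (g h : PQ -> W) : linear g -> linear h ->
  (forall p q, g (pureB p q) = h (pureB p q)) -> g =1 h.
Proof.
move=> hg hh e; elim/pureB_ind => [|x y ex ey|//].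
  by rewrite (linear0E hg) (linear0E hh).
by rewrite (linearDE _ _ hg) (linearDE _ _ hh) ex ey.
Qed.

Section LiftB.
Variables (W : lmodType K) (f : P -> Q -> W) (hf : bilin f).
Hypothesis f_bal : forall p a q, f (p ⊲ a) q = f p (a ⊳ q).

Let bal : balanced (fun a => ract P a) (fun (a : A) (q : Q) => a ⊳ q) f.
Proof. by split=> [v v' w|v w w'|a v w];
  rewrite ?(bilinDl hf) ?(bilinDr hf). Qed.

Lemma liftA_pureB p q : liftA f (pureB p q) = f p q.
Proof. exact: tlift_pure. Qed.

Lemma liftA_linear : linear (liftA f : PQ -> W).
Proof. by apply: tlift_linear => // k v w; rewrite (bilinZl hf). Qed.

End LiftB.
End Tensors.
End BimoduleTheory.

(** * The right coaction *)

Section Coaction.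
Variables (K : comNzRingType) (A : algType K) (H : hopf_algebra A).
Variables (G : bicovariant_calculus H).
Local Notation T := (tpow G).
Local Notation d := (dif G).
Local Notation mulA := (@GRing.mul A).
Local Notation actl := (fun a (v : bimod_sort _) => a ⊳ v).
Local Notation actr := (fun (v : bimod_sort _) a => v ⊲ a).

Local Ltac bil := by [apply: bilin_mul | apply: bilin_lact | apply:
  bilin_ract | apply: bilin_pureB].

Lemma forms_ind (C : G -> Prop) :
  C 0 -> (forall x y, C x -> C y -> C (x + y)) -> (forall a b, C (a ⊳ d b)) ->
  forall x, C x.
Proof.
move=> C0 CD Cg x; have [s ->] := dif_span x.
by elim/big_rec: _ => // p y _; apply: CD.
Qed.

Lemma forms_ext (W : lmodType K) (g h : G -> W) : linear g -> linear h ->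
  (forall a b, g (a ⊳ d b) = h (a ⊳ d b)) -> g =1 h.
Proof.
move=> hg hh e; elim/forms_ind => [|x y ex ey|//].
  by rewrite (linear0E hg) (linear0E hh).
by rewrite (linearDE _ _ hg) (linearDE _ _ hh) ex ey.
Qed.

Lemma tmap2_11l (P : bimodule A) (x : P ⊗ A) : tmap2 actl mulA (1 ⊗ 1) x = x.
Proof.
have B := bilin_tmap2 (@bilin_lact K A P) (@bilin_mul _ A).
move: x; apply: tensK_ext => [||u v]; [exact: B.1 | by [] |].
by rewrite (tmap2_pure (bilin_lact _) (@bilin_mul _ A)) lact1 mul1r.
Qed.

Let ld : linear d. Proof. exact: linearP. Qed.
Let lid : linear (@id A). Proof. by []. Qed.
#[local] Hint Resolve ld lid : core.

Lemma coR_dif b : coR G (d b) = tmap d id (H b).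
Proof. by rewrite -[d b in LHS]lact1 coRE cop1 tmap2_11l. Qed.

Lemma coR_lact a rho : coR G (a ⊳ rho) = tmap2 actl mulA (H a) (coR G rho).
Proof.
have B := bilin_tmap2 (@bilin_lact K A G) (@bilin_mul _ A).
move: rho; apply: forms_ext => [||b c].
- by apply: linear_comp; apply: linearP.
- by apply: linear_comp; [exact: B.1|apply: linearP].
rewrite -lactM !coRE copM; apply: tmap2A => *; try bil; first exact: lactM.
by rewrite mulrA.
Qed.

Lemma tmap_difM (x y : A ⊗ A) :
  tmap d id (tmap2 mulA mulA x y) =
  tmap2 actr mulA (tmap d id x) y + tmap2 actl mulA x (tmap d id y).
Proof.
have B1 := bilin_tmap2 (@bilin_mul _ A) (@bilin_mul _ A).
have B2 := bilin_tmap2 (@bilin_ract K A G) (@bilin_mul _ A).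
have B3 := bilin_tmap2 (@bilin_lact K A G) (@bilin_mul _ A).
have L := tmap_linear ld lid.
elim/tensK_ind: x => [|x x' ex ex'|u v].
- by rewrite (bilin0l B1) (linear0E L) (bilin0l B2) (bilin0l B3) addr0.
- rewrite (bilinDl B1) !(linearDE _ _ L) (bilinDl B2) (bilinDl B3) ex ex'.
  by rewrite addrACA.
elim/tensK_ind: y => [|x x' ex ex'|u' v'].
- by rewrite (bilin0r B1) (linear0E L) (bilin0r B2) (bilin0r B3) addr0.
- rewrite (bilinDr B1) !(linearDE _ _ L) (bilinDr B2) (bilinDr B3) ex ex'.
  by rewrite addrACA.
rewrite (tmap2_pure (@bilin_mul _ A) (@bilin_mul _ A)) !(tmap_pure ld lid).
rewrite (tmap2_pure (bilin_ract _) (@bilin_mul _ A)) (tmap2_pure (bilin_lact _)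
  (@bilin_mul _ A)) difM.
by rewrite (bilinDl (@bilin_pureK _ _ _)).
Qed.

Lemma coR_ract rho b : coR G (rho ⊲ b) = tmap2 actr mulA (coR G rho) (H b).
Proof.
have B2 := bilin_tmap2 (@bilin_ract K A G) (@bilin_mul _ A).
have B3 := bilin_tmap2 (@bilin_lact K A G) (@bilin_mul _ A).
move: rho; apply: forms_ext => [||a c].
- by apply: linear_comp; apply: linearP.
- by apply: linear_comp; [exact: B2.2|apply: linearP].
(* the right action on generators, by the Leibniz rule *)
have -> : a ⊳ d c ⊲ b = a ⊳ d (c * b) - (a * c) ⊳ d b.
  by rewrite difM linearD lactM addrK -lract.
rewrite linearB /= !coRE !copM tmap_difM (bilinDr B3).
apply/eqP; rewrite subr_eq; apply/eqP; rewrite addrC.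
rewrite (tmap2A (g3 := actl) (h3 := mulA) (g4 := actl) (h4 := mulA)); try bil.
- by rewrite [in RHS]addrC; congr (_ + _); symmetry; apply: tmap2A => *;
    try bil; rewrite ?lract ?mulrA.
- by move=> *; rewrite lactM.
- by move=> *; rewrite mulrA.
Qed.

(** ** Tensor powers of the bimodule of one-forms *)

(** [x (x)_A rho] in Gamma^(x)(n+1), for [x] in Gamma^(x)n. *)
Definition snoc n (x : T n) (rho : G) : T n.+1 := pureB x rho.

Lemma bilin_snoc n : bilin (@snoc n). Proof. exact: bilin_pureB. Qed.

Lemma snoc_bal n (x : T n) a rho : snoc (x ⊲ a) rho = snoc x (a ⊳ rho).
Proof. exact: pureB_bal. Qed.

Lemma lact_snoc n a (x : T n) rho : a ⊳ snoc x rho = snoc (a ⊳ x) rho.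
Proof. exact: lact_pureB. Qed.

Lemma ract_snoc n (x : T n) rho a : snoc x rho ⊲ a = snoc x (rho ⊲ a).
Proof. exact: ract_pureB. Qed.

Lemma snoc_ind n (C : T n.+1 -> Prop) :
  C 0 -> (forall x y, C x -> C y -> C (x + y)) ->
  (forall x rho, C (snoc x rho)) -> forall x, C x.
Proof. exact: pureB_ind. Qed.

Lemma snoc_ext n (W : lmodType K) (g h : T n.+1 -> W) : linear g -> linear h ->
  (forall x rho, g (snoc x rho) = h (snoc x rho)) -> g =1 h.
Proof. exact: pureB_ext. Qed.

(** The right coaction on tensor powers is compatible with the right action of
    the algebra; this is what makes the next one well defined on tensors over
    the algebra, so the two facts are proved together. *)
Lemma coRn_spec n : [/\ linear (@coRn _ _ _ G n),
  forall (x : T n) a, coRn (x ⊲ a) = tmap2 actr mulA (coRn x) (H a) &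
  if n is m.+1 then forall (x : T m) rho,
     coRn (snoc x rho) = tmap2 (@snoc m) mulA (coRn x) (coR G rho) else True].
Proof.
elim: n => [|n [lin hr _]]; first by split=> [|x a|//];
  [apply: linearP|apply: copM].
pose f (x : T n) rho := tmap2 (@snoc n) mulA (coRn x) (coR G rho).
have Bs := bilin_tmap2 (@bilin_snoc n) (@bilin_mul _ A).
have Br := bilin_tmap2 (@bilin_ract _ _ (T n.+1)) (@bilin_mul _ A).
have Bf : bilin f.
  split=> [x|rho]; last exact: linear_comp (Bs.2 _) lin.
  by apply: linear_comp (Bs.1 _) _; apply: linearP.
have fbal x a rho : f (x ⊲ a) rho = f x (a ⊳ rho).
  rewrite /f hr coR_lact; apply: tmap2A => *; try bil; try exact: bilin_snoc.
    exact: snoc_bal.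
  by rewrite mulrA.
have e3 (x : T n) rho : coRn (snoc x rho) = f x rho by exact: liftA_pureB.
have lin1 : linear (@coRn _ _ _ G n.+1) by exact: liftA_linear.
split=> // x a; move: x; apply: snoc_ext.
- exact: (linear_comp lin1 ((@bilin_ract _ _ (T n.+1)).2 a)).
- exact: (linear_comp (Br.2 _) lin1).
move=> x rho; rewrite ract_snoc !e3 /f coR_ract; symmetry.
by apply: tmap2A => *; try bil; try exact: bilin_snoc;
  rewrite ?ract_snoc ?mulrA.
Qed.

Lemma coRn_snoc n (x : T n) rho :
  coRn (snoc x rho) = tmap2 (@snoc n) mulA (coRn x) (coR G rho).
Proof. by case: (coRn_spec n.+1). Qed.

(** Contraction of the right coaction with a functional on the algebra; for the
    functionals chi_i these are the Lie derivatives. *)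
Definition coact (psi : A -> K) n (x : T n) : T n := slice psi (coRn x).

Lemma coact_linear (psi : {scalar A}) n : linear (@coact psi n).
Proof. by apply: linear_comp; [apply: slice_linear|case: (coRn_spec n)]. Qed.

HB.instance Definition _ (psi : {scalar A}) n :=
  GRing.isLinear.Build K _ _ _ (@coact psi n) (@coact_linear psi n).

Lemma coact_snoc (psi : {scalar A}) n (x : T n) rho I (r : seq I)
    (rh : I -> G) (a : I -> A) : coR G rho = \sum_(q <- r) rh q ⊗ a q ->
  coact psi (snoc x rho) =
  \sum_(q <- r) snoc (coact (rtrans psi (a q)) x) (rh q).
Proof.
move=> e; have B := bilin_tmap2 (@bilin_snoc n) (@bilin_mul _ A).
rewrite /coact coRn_snoc e (bilin_sumr B) linear_sum; apply: eq_bigr => q _ /=.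
exact: (slice_tmap2r psi _ _ _ (@bilin_snoc n)).
Qed.

Lemma conv_linear (psi : {scalar A}) : linear (conv H psi).
Proof. by apply: (linear_comp (slice_linear psi)); apply: linearP. Qed.

HB.instance Definition _ (psi : {scalar A}) :=
  GRing.isLinear.Build K _ _ _ (conv H psi) (conv_linear psi).

Lemma slice_coR_dif (psi : {scalar A}) b : slice psi (coR G (d b)) =
  d (conv H psi b).
Proof. by rewrite coR_dif slice_tmapl. Qed.

Lemma coact_mul (psi : {scalar A}) I (r : seq I) (phi theta : I -> {scalar A})
    n (x : T n) rho :
  (forall a b, psi (a * b) = \sum_(i <- r) phi i a * theta i b) ->
  coact psi (snoc x rho) =
  \sum_(i <- r) snoc (coact (phi i) x) (slice (theta i) (coR G rho)).
Proof.
by move=> e; rewrite /coact coRn_snoc; apply: slice_tmap2 => //;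
  apply: bilin_snoc.
Qed.

Lemma coact_counit n (x : T n) : coact (counit H) x = x.
Proof.
elim: n x => [|n IH]; first by move=> a; exact: counitr.
apply: snoc_ext => [||x rho]; [exact: linearP|by []|].
move: rho; elim/forms_ind => [|r r' e e'|a b].
- by rewrite (bilin0r (@bilin_snoc n)) linear0.
- by rewrite (bilinDr (@bilin_snoc n)) linearD /= e e'.
rewrite -snoc_bal; move: (x ⊲ a) => {a}x.
rewrite (@coact_mul _ unit [:: tt] (fun=> counit H) (fun=> counit H)).
  by rewrite big_seq1 slice_coR_dif IH; congr (snoc _ (d _)); exact: counitr.
by move=> u v; rewrite big_seq1 counitM.
Qed.
End Coaction.

(** * The structure functionals of a left-invariant frame *)

Section Frame.
Variables (K : comNzRingType) (A : algType K) (H : hopf_algebra A).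
Variables (G : bicovariant_calculus H) (F : invariant_frame G).
Local Notation N := (fdim F).
Local Notation T := (tpow G).
Local Notation d := (dif G).
Local Notation om := (omega F).
Local Notation mulA := (@GRing.mul A).
Local Notation eps := (counit H).
Local Notation actl := (fun a (v : bimod_sort _) => a ⊳ v).
Local Notation actr := (fun (v : bimod_sort _) a => v ⊲ a).

(** The left coefficient of a one-form on [omega i]. *)
Definition lcoef (i : 'I_N) (rho : G) : A := sval (cid (omega_lfree F rho)) i.

Lemma lcoefE rho : rho = \sum_i lcoef i rho ⊳ om i.
Proof. by rewrite /lcoef; case: cid => c [] /=. Qed.

Lemma lcoef_uniq rho (c : 'I_N -> A) : rho = \sum_i c i ⊳ om i ->
  forall i, lcoef i rho = c i.
Proof.
rewrite /lcoef; case: cid => c' [_ /= u] e i.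
rewrite (u [ffun i => c i]) ?ffunE // {1}e.
by apply: eq_bigr => j _; rewrite ffunE.
Qed.

Lemma lcoef_linear i : linear (lcoef i).
Proof.
move=> k u v; move: i.
apply: (lcoef_uniq (c := fun i => k *: lcoef i u + lcoef i v)).
rewrite [in LHS](lcoefE u) [in LHS](lcoefE v) scaler_sumr -big_split.
apply: eq_bigr => i _ /=.
by rewrite (bilinDl (@bilin_lact _ _ G)) (bilinZl (@bilin_lact _ _ G)).
Qed.

HB.instance Definition _ i := GRing.isLinear.Build K _ _ _ (lcoef i)
  (lcoef_linear i).

Lemma lcoef_lact i a rho : lcoef i (a ⊳ rho) = a * lcoef i rho.
Proof.
move: i; apply: (lcoef_uniq (c := fun i => a * lcoef i rho)).
by rewrite {1}(lcoefE rho) linear_sum; apply: eq_bigr => i _; rewrite lactM.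
Qed.

Lemma lcoef_omega i j : lcoef i (om j) = (i == j)%:R.
Proof.
move: i; apply: (lcoef_uniq (c := fun i => (i == j)%:R)).
rewrite (bigD1 j) //= eqxx lact1 big1 ?addr0 // => i /negbTE ->.
exact: (bilin0l (@bilin_lact _ _ G)).
Qed.

Lemma lcoef_ract i rho b : lcoef i (rho ⊲ b) =
  \sum_m lcoef m rho * conv H (sf F m i) b.
Proof.
rewrite {1}(lcoefE rho) (linear_sum (ract G b)) linear_sum;
  apply: eq_bigr => m _.
by rewrite /= -lract lcoef_lact (lcoef_uniq (sfE m b)).
Qed.

Lemma lcoef_dif i b : lcoef i (d b) = conv H (chi F i) b.
Proof. by move: i; apply: (lcoef_uniq (c := fun i => _)); exact: chiE. Qed.

Lemma counit_conv (psi : {scalar A}) a : eps (conv H psi a) = psi a.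
Proof.
have := congr1 psi (counitl H a); rewrite -[_ a in RHS]/(psi a) => <-.
rewrite -[Defs.liftK _ _]/(lslice eps (H a)) -[conv _ _ _]/(slice psi (H a)).
elim/tensK_ind: (H a) => [|x y ex ey|u v]; first by rewrite !linear0.
  by rewrite !linearD /= ex ey.
by rewrite slice_pure lslice_pure !linearZ /= mulrC.
Qed.

Lemma sf_mul i l a b : sf F i l (a * b) = \sum_k sf F i k a * sf F k l b.
Proof.
rewrite -(counit_conv (sf F i l)) -(lcoef_uniq (sfE i (a * b)))
  ractM lcoef_ract.
rewrite linear_sum; apply: eq_bigr => k _ /=.
by rewrite (lcoef_uniq (sfE i a)) counitM !counit_conv.
Qed.

(** The twisted Leibniz rule of the tangent functionals. *)
Lemma chi_mul l a b :
  chi F l (a * b) = \sum_k chi F k a * sf F k l b + eps a * chi F l b.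
Proof.
rewrite -(counit_conv (chi F l)) -lcoef_dif difM linearD /= lcoef_ract
  lcoef_lact lcoef_dif.
rewrite linearD linear_sum /= counitM counit_conv; congr (_ + _).
by apply: eq_bigr => k _ /=; rewrite lcoef_dif counitM !counit_conv.
Qed.

(** The counit of the left coefficient on [omega m]: the coordinates of
    invariant forms, extended to all one-forms. *)
Definition lceps (m : 'I_N) (rho : G) : K := eps (lcoef m rho).

Lemma lceps_scalar m : scalar (lceps m).
Proof. by move=> k u v; rewrite /lceps !linearP. Qed.

HB.instance Definition _ m := GRing.isLinear.Build K _ _ _ (lceps m)
  (lceps_scalar m).

Lemma lceps_lact m a rho : lceps m (a ⊳ rho) = eps a * lceps m rho.
Proof. by rewrite /lceps lcoef_lact counitM. Qed.

Lemma lceps_omega m j : lceps m (om j) = (m == j)%:R.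
Proof.
rewrite /lceps lcoef_omega; case: eqP => _; first exact: counit1.
exact: linear0.
Qed.

(** The coefficient on [omega m] of the right coaction, the left algebra
    coefficients being sent to scalars by the counit; it extends
    [omega k |-> M_m^k] to all one-forms. *)
Definition coRcoef (m : 'I_N) (rho : G) : A := lslice (lceps m) (coR G rho).

Lemma coRcoef_linear m : linear (coRcoef m).
Proof. by apply: (linear_comp (lslice_linear _)); apply: linearP. Qed.

HB.instance Definition _ m :=
  GRing.isLinear.Build K _ _ _ (coRcoef m) (coRcoef_linear m).

Lemma coRcoef_omega m k : coRcoef m (om k) = sM F m k.
Proof.
rewrite /coRcoef sME linear_sum (bigD1 m)
  //= lslice_pure /= lceps_omega eqxx scale1r.
by rewrite big1 ?addr0 // => i /negbTE ne;
  rewrite lslice_pure /= lceps_omega eq_sym ne scale0r.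
Qed.

Lemma coRcoef_lact m a rho : coRcoef m (a ⊳ rho) = a * coRcoef m rho.
Proof.
rewrite /coRcoef coR_lact -[a in RHS](counitl H).
rewrite -[Defs.liftK _ _]/(lslice eps (H a)).
have B := bilin_tmap2 (@bilin_lact _ _ G) (@bilin_mul _ A).
elim/tensK_ind: (H a) => [|x y ex ey|u v].
- by rewrite (bilin0l B) !linear0 mul0r.
- by rewrite (bilinDl B) !linearD /= ex ey mulrDl.
elim/tensK_ind: (coR G rho) => [|x y ex ey|r w].
- by rewrite (bilin0r B) !linear0 mulr0.
- by rewrite (bilinDr B) !linearD /= ex ey mulrDr.
rewrite (tmap2_pure (@bilin_lact _ _ G) (@bilin_mul _ A))
  !lslice_pure /= lceps_lact.
by rewrite -scalerAl -scalerAr scalerA.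
Qed.

(** psi(a_1) a_2, the mirror image of [conv]. *)
Definition rconv (psi : A -> K) (a : A) : A := lslice psi (H a).

(** The Yetter-Drinfeld relation between the right action and the right coaction
    on invariant forms: compute the coaction of [omega s . a] in two ways. *)
Lemma yetter_drinfeld m s a :
  \sum_i sM F i s * rconv (sf F i m) a = \sum_k conv H (sf F s k) a * sM F m k.
Proof.
transitivity (coRcoef m (om s ⊲ a)); last first.
  rewrite sfE linear_sum; apply: eq_bigr => k _.
  by rewrite /= coRcoef_lact coRcoef_omega.
have B := bilin_tmap2 (@bilin_ract _ _ G) (@bilin_mul _ A).
rewrite /coRcoef coR_ract sME (bilin_suml B) linear_sum; apply: eq_bigr => i _.
rewrite /rconv /=; elim/tensK_ind: (H a) => [|x y ex ey|u v].
- by rewrite (bilin0r B) !linear0 mulr0.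
- by rewrite (bilinDr B) !linearD /= -ex -ey mulrDr.
rewrite (tmap2_pure (@bilin_ract _ _ G) (@bilin_mul _ A)) !lslice_pure /=.
by rewrite /lceps (lcoef_uniq (sfE i u)) counit_conv -scalerAr.
Qed.

Lemma cop_rconv (psi : {scalar A}) b : H (rconv psi b) =
  tmap (rconv psi) id (H b).
Proof.
have lr : linear (rconv psi).
  by apply: (linear_comp (lslice_linear psi)); apply: linearP.
have li : linear (@id A) by [].
have lH : linear H by apply: linearP.
have Bp := @bilin_pureK K.
have Bin (w : A) : bilin (fun u v : A => u ⊗ (v ⊗ w)).
  split=> [u k v v'|v k u u'].
    by rewrite (bilinDl (Bp _ _)) (bilinZl (Bp _ _)) (bilinDr (Bp _ _))
      (bilinZr (Bp _ _)).
  by rewrite (bilinDl (Bp _ _)) (bilinZl (Bp _ _)).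
have Ba : bilin (fun (x : A ⊗ A) (w : A) => Defs.liftK (fun u v =>
  u ⊗ (v ⊗ w)) x).
  split=> [x k w w'|w]; last exact: liftK_linear (Bin w).
  elim/tensK_ind: x => [|x y ex ey|u v].
  - by rewrite !(linear0E (liftK_linear (Bin _))) scaler0 addr0.
  - by rewrite !(linearDE _ _ (liftK_linear (Bin _))) ex ey scalerDr addrACA.
  rewrite !(liftK_pure _ _ (Bin _)).
  by rewrite (bilinDr (Bp _ _)) (bilinZr (Bp _ _)) (bilinDr (Bp _ _))
    (bilinZr (Bp _ _)).
have := congr1 (lslice psi) (coassoc H b).
have -> : lslice psi (tmap id H (H b)) = H (lslice psi (H b)).
  elim/tensK_ind: (H b) => [|x y ex ey|u v].
  - by rewrite (linear0E (tmap_linear li lH)) !linear0.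
  - by rewrite (linearDE _ _ (tmap_linear li lH)) !linearD /= ex ey.
  by rewrite (tmap_pure li lH) !lslice_pure linearZ.
rewrite /rconv => <-; rewrite -/(rconv psi) /tassoc.
elim/tensK_ind: (H b) => [|x y ex ey|u v].
- by rewrite !(linear0E (tmap_linear _ li)) // (linear0E (liftK_linear Ba))
    !linear0.
- by rewrite !(linearDE _ _ (tmap_linear _ li))
    // (linearDE _ _ (liftK_linear Ba)) linearD /= ex ey.
rewrite !(tmap_pure _ li) // (liftK_pure _ _ Ba) /rconv.
elim/tensK_ind: (H u) => [|x y ex ey|a a'].
- by rewrite (linear0E (liftK_linear (Bin v))) !linear0 (bilin0l (Bp _ _)).
- by rewrite (linearDE _ _ (liftK_linear (Bin v)))
    !linearD /= ex ey (bilinDl (Bp _ _)).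
by rewrite (liftK_pure _ _ (Bin v)) !lslice_pure (bilinZl (Bp _ _)).
Qed.

Lemma cop_coRcoef j rho : H (coRcoef j rho) = tmap (coRcoef j) id (coR G rho).
Proof.
have li : linear (@id A) by [].
have ld : linear d by apply: linearP.
have lcc : linear (coRcoef j) by apply: linearP.
have L := tmap_linear lcc li; have L' := tmap_linear ld li.
have cd b : coRcoef j (d b) = rconv (chi F j) b.
  rewrite /coRcoef coR_dif; apply: lslice_tmapl => u /=.
  by rewrite /lceps lcoef_dif counit_conv.
move: rho; apply: forms_ext => [||a b].
- by apply: linear_comp; apply: linearP.
- by apply: (linear_comp L); apply: linearP.
rewrite coRcoef_lact cd copM cop_rconv coRE.
have B := bilin_tmap2 (@bilin_mul _ A) (@bilin_mul _ A).
have B' := bilin_tmap2 (@bilin_lact _ _ G) (@bilin_mul _ A).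
have lr : linear (rconv (chi F j)) by apply: (linear_comp (lslice_linear _));
  apply: linearP.
elim/tensK_ind: (H a) => [|x y ex ey|u v].
- by rewrite (bilin0l B) (bilin0l B') (linear0E L).
- by rewrite (bilinDl B) (bilinDl B') (linearDE _ _ L) ex ey.
elim/tensK_ind: (H b) => [|x y ex ey|u' v'].
- by rewrite (linear0E (tmap_linear lr li)) (linear0E L') (bilin0r B)
    (bilin0r B') (linear0E L).
- by rewrite (linearDE _ _ (tmap_linear lr li)) (linearDE _ _ L') (bilinDr B)
    (bilinDr B') (linearDE _ _ L) ex ey.
rewrite (tmap_pure lr li) (tmap_pure ld li) (tmap2_pure (@bilin_mul _ A)
  (@bilin_mul _ A)).
rewrite (tmap2_pure (@bilin_lact _ _ G) (@bilin_mul _ A)) (tmap_pure lcc li).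
by rewrite coRcoef_lact cd.
Qed.

(** The coproduct of the entries of M. *)
Lemma cop_sM j k : H (sM F j k) = \sum_i sM F j i ⊗ sM F i k.
Proof.
have li : linear (@id A) by [].
have lcc : linear (coRcoef j) by apply: linearP.
rewrite -coRcoef_omega cop_coRcoef sME (linear_sumE _ _ _ (tmap_linear lcc li)).
by apply: eq_bigr => i _; rewrite (tmap_pure lcc li) coRcoef_omega.
Qed.

Lemma yetter_drinfeld_sM m s p q :
  \sum_i \sum_j sf F i m (sM F q j) *: (sM F i s * sM F j p) =
  \sum_k \sum_j sf F s k (sM F j p) *: (sM F q j * sM F m k).
Proof.
transitivity (\sum_i sM F i s * rconv (sf F i m) (sM F q p)).
  apply: eq_bigr => i _; rewrite /rconv cop_sM linear_sum mulr_sumr.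
  by apply: eq_bigr => j _; rewrite /= lslice_pure -scalerAr.
rewrite yetter_drinfeld; apply: eq_bigr => k _.
rewrite -[conv _ _ _]/(slice (sf F s k) (H (sM F q p)))
  cop_sM linear_sum mulr_suml.
by apply: eq_bigr => j _; rewrite /= slice_pure -scalerAl.
Qed.

(** [(id (x) f^i_l)] applied to the right coaction. *)
Definition sfcoR (i l : 'I_N) (rho : G) : G := slice (sf F i l) (coR G rho).

Lemma sfcoR_linear i l : linear (sfcoR i l).
Proof. by apply: (linear_comp (slice_linear _)); apply: linearP. Qed.

HB.instance Definition _ i l :=
  GRing.isLinear.Build K _ _ _ (sfcoR i l) (sfcoR_linear i l).

Lemma sfcoR_lact i l c rho :
  sfcoR i l (c ⊳ rho) = \sum_j conv H (sf F i j) c ⊳ sfcoR j l rho.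
Proof.
rewrite /sfcoR coR_lact; apply: (slice_tmap2 _ _ (@bilin_lact _ _ G)) => a b.
exact: sf_mul.
Qed.

Lemma sfcoR_ract i l b rho :
  sfcoR i l (rho ⊲ b) = \sum_m sfcoR i m rho ⊲ conv H (sf F m l) b.
Proof.
rewrite /sfcoR coR_ract; apply: (slice_tmap2 _ _ (@bilin_ract _ _ G)) => a c.
exact: sf_mul.
Qed.

Lemma sfcoR_dif i l b : sfcoR i l (d b) = d (conv H (sf F i l) b).
Proof. exact: slice_coR_dif. Qed.

Lemma sfcoR_omega i l k : sfcoR i l (om k) = \sum_m sf F i l (sM F m k) *: om m.
Proof.
rewrite /sfcoR sME linear_sum; apply: eq_bigr => m _ /=.
by rewrite slice_pure.
Qed.

End Frame.

(** * The skew derivations *)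

#[local] Arguments tpow : simpl never.
#[local] Arguments lact : simpl never.
#[local] Arguments ract : simpl never.

Section SkewDerivation.
Variables (K : comNzRingType) (A : algType K) (H : hopf_algebra A).
Variables (G : bicovariant_calculus H) (F : invariant_frame G).
Local Notation N := (fdim F).
Local Notation T := (tpow G).
Local Notation d := (dif G).
Local Notation om := (omega F).

(** The coefficient of a tensor on its last factor [omega k]. *)
Definition lastc (k : 'I_N) n : T n.+1 -> T n :=
  liftA (fun (x : T n) (rho : G) => x ⊲ lcoef k rho).

Section Projections.
Variables (k : 'I_N) (n : nat).

Let f (x : T n) (rho : G) := x ⊲ lcoef k rho.
Let hf : bilin f.
Proof.
split=> [x|rho]; last exact: linearP.
by apply: (linear_comp ((bilin_ract _).1 x)); apply: linearP.
Qed.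
Let f_bal x a rho : f (x ⊲ a) rho = f x (a ⊳ rho).
Proof. by rewrite /f lcoef_lact ractM. Qed.

Lemma lastc_linear : linear (@lastc k n).
Proof. exact: (liftA_linear hf f_bal). Qed.

Lemma lastc_snoc (x : T n) rho : lastc k (snoc x rho) = x ⊲ lcoef k rho.
Proof. exact: (liftA_pureB hf f_bal). Qed.

End Projections.

HB.instance Definition _ k n :=
  GRing.isLinear.Build K _ _ _ (@lastc k n) (@lastc_linear k n).

Lemma lastc_omega k n j (x : T n) : lastc k (snoc x (om j)) = (k == j)%:R *: x.
Proof.
rewrite lastc_snoc lcoef_omega; case: eqP => _; first by rewrite ract1 scale1r.
by rewrite (bilin0r (@bilin_ract _ _ _)) scale0r.
Qed.

Lemma snoc_dec n (x : T n.+1) : x = \sum_k snoc (lastc k x) (om k).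
Proof.
elim/snoc_ind: x => [|x y {1}-> {1}->|x rho].
- by rewrite big1 // => k _; rewrite linear0 (bilin0l (@bilin_snoc _ _ _ _ _)).
- rewrite -big_split; apply: eq_bigr => k _ /=.
  by rewrite linearD (bilinDl (@bilin_snoc _ _ _ _ _)).
rewrite [in LHS](lcoefE F rho) (bilin_sumr (@bilin_snoc _ _ _ _ _)).
by apply: eq_bigr => k _; rewrite lastc_snoc snoc_bal.
Qed.

Lemma lastc_sum k n (x : 'I_N -> T n) :
  lastc k (\sum_l snoc (x l) (om l)) = x k.
Proof.
rewrite linear_sum (bigD1 k) //= lastc_omega eqxx scale1r big1 ?addr0 // =>
  l ne.
by rewrite lastc_omega eq_sym (negbTE ne) scale0r.
Qed.

(** The operators D_l, defined by
    D_l (x (x) omega^k) =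
      delta^k_l x - sum_i D_i x (x) (id (x) f^i_l) (coR omega^k).
    The inner match makes D_i vanish in degree zero. *)
Fixpoint sder n (l : 'I_N) : T n.+1 -> T n := fun x =>
  lastc l x - \sum_i \sum_k
    (match n return T n -> T n with
     | 0 => fun _ => 0
     | m.+1 => fun y : T m.+1 => snoc (sder i y) (sfcoR i l (om k))
     end) (lastc k x).

(** [D_i x (x) rho], which is zero for [x] in degree zero; with it, formulas for
    [sder] need no case distinction on the degree. *)
Definition sder_snoc n (i : 'I_N) : T n -> G -> T n :=
  match n return T n -> G -> T n with
  | 0 => fun _ _ => 0
  | m.+1 => fun y rho => snoc (sder i y) rho
  end.

#[local] Arguments sder : simpl never.
#[local] Arguments sder_snoc : simpl never.

Lemma sderE n l (x : T n.+1) :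
  sder l x = lastc l x - \sum_i \sum_k sder_snoc i (lastc k x)
    (sfcoR i l (om k)).
Proof. by case: n x. Qed.

Lemma sder_snocS n i (x : T n.+1) rho : sder_snoc i x rho = snoc (sder i x) rho.
Proof. by []. Qed.

Lemma sder_snoc_ractr n i (x : T n) rho b :
  sder_snoc i x rho ⊲ b = sder_snoc i x (rho ⊲ b).
Proof. by case: n x => [|n] x; [exact: linear0|exact: ract_snoc]. Qed.

(** Linearity and the twisted right module rule
    D_i (x b) = sum_m (D_m x) (f^m_i * b), to be propagated through degrees. *)
Definition sder_snoc_spec n := forall i : 'I_N,
  bilin (@sder_snoc n i) /\
  forall b x rho, @sder_snoc n i (x ⊲ b) rho =
    \sum_m sder_snoc m x (conv H (sf F m i) b ⊳ rho).

Section Step.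
Variables (n : nat) (IH : sder_snoc_spec n).

Let Bn i : bilin (@sder_snoc n i). Proof. by case: (IH i). Qed.

Lemma sder_linear_step l : linear (@sder n l).
Proof.
move=> k x y; rewrite !sderE linearP /= scalerBr addrACA -opprD; congr (_ - _).
rewrite scaler_sumr -big_split; apply: eq_bigr => i _ /=.
rewrite scaler_sumr -big_split; apply: eq_bigr => j _ /=.
by rewrite linearP (Bn i).2.
Qed.

(** The left coefficients of rho move to x, where D_i picks up f, and are
    collected again by [sfcoR_lact]. *)
Lemma sder_snocE_step l x rho : @sder n l (snoc x rho) =
  x ⊲ lcoef l rho - \sum_i sder_snoc i x (sfcoR i l rho).
Proof.
rewrite sderE lastc_snoc; congr (_ - _).
under eq_bigr => i _ do under eq_bigr => k _ do rewrite lastc_snoc.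
have E i k : sder_snoc i (x ⊲ lcoef k rho) (sfcoR i l (om k)) =
    \sum_m sder_snoc m x (conv H (sf F m i) (lcoef k rho) ⊳ sfcoR i l (om k)).
  by case: (IH i).
under eq_bigr => i _ do under eq_bigr => k _ do rewrite E.
rewrite exchange_big /=; under eq_bigr => k _ do rewrite exchange_big /=.
rewrite exchange_big /=; apply: eq_bigr => m _.
rewrite {2}(lcoefE F rho) linear_sum (bilin_sumr (Bn m)).
by apply: eq_bigr => k _ /=; rewrite sfcoR_lact (bilin_sumr (Bn m)).
Qed.

Lemma sder_ract_step l b x :
  @sder n l (x ⊲ b) = \sum_m sder m x ⊲ conv H (sf F m l) b.
Proof.
have lin := sder_linear_step.
elim/snoc_ind: x => [|x y ex ey|x rho].
- rewrite linear0 (linear0E (lin l)) big1 // => m _.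
  by rewrite (linear0E (lin m)) linear0.
- rewrite linearD /= (linearDE _ _ (lin l)) ex ey -big_split.
  by apply: eq_bigr => m _ /=; rewrite (linearDE _ _ (lin m)) linearD.
rewrite ract_snoc sder_snocE_step lcoef_ract (bilin_sumr (@bilin_ract _ _ _)).
under [RHS]eq_bigr => m _ do rewrite sder_snocE_step linearB.
rewrite big_split /=; congr (_ + _).
  by apply: eq_bigr => m _; rewrite ractM.
rewrite sumrN; congr (- _).
under [RHS]eq_bigr => m _ do rewrite linear_sum.
rewrite exchange_big; apply: eq_bigr => i _ /=.
rewrite sfcoR_ract (bilin_sumr (Bn i)); apply: eq_bigr => m _.
by rewrite sder_snoc_ractr.
Qed.
End Step.

Lemma sder_snocP n : sder_snoc_spec n.
Proof.
elim: n => [|n IH] i.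
  split=> [|b x rho]; last by rewrite big1.
  by split=> ? k ? ?; rewrite scaler0 addr0.
have Bs := @bilin_snoc _ _ _ G n.
split=> [|b x rho].
  split=> [x|rho]; first exact: (Bs.1 _).
  by apply: (linear_comp (Bs.2 rho)); exact: sder_linear_step.
rewrite sder_snocS sder_ract_step // (bilin_suml Bs).
by apply: eq_bigr => m _; rewrite snoc_bal.
Qed.

Lemma bilin_sder_snoc n i : bilin (@sder_snoc n i).
Proof. by case: (sder_snocP n i). Qed.

Lemma sder_linear n l : linear (@sder n l).
Proof. exact/sder_linear_step/sder_snocP. Qed.

HB.instance Definition _ n l :=
  GRing.isLinear.Build K _ _ _ (@sder n l) (@sder_linear n l).

Lemma sder_sum n l I (r : seq I) (P : pred I) (x : I -> T n.+1) :
  sder l (\sum_(i <- r | P i) x i) = \sum_(i <- r | P i) sder l (x i).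
Proof. exact: (linear_sum (@sder n l)). Qed.

Lemma sder_snocE n l (x : T n) rho : sder l (snoc x rho) =
  x ⊲ lcoef l rho - \sum_i sder_snoc i x (sfcoR i l rho).
Proof. exact/sder_snocE_step/sder_snocP. Qed.

Lemma sder_snoc_dif n l (x : T n) b : sder l (snoc x (d b)) =
  x ⊲ conv H (chi F l) b - \sum_i sder_snoc i x (d (conv H (sf F i l) b)).
Proof.
rewrite sder_snocE lcoef_dif; congr (_ - _).
by apply: eq_bigr => i _; rewrite sfcoR_dif.
Qed.

Lemma sder_snoc_omega n l (x : T n) p : sder l (snoc x (om p)) =
  (l == p)%:R *: x -
  \sum_i \sum_q sf F i l (sM F q p) *: sder_snoc i x (om q).
Proof.
rewrite sderE !lastc_omega; congr (_ - _); apply: eq_bigr => i _.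
rewrite (bigD1 p) //= big1 ?addr0 => [|k ne]; rewrite lastc_omega.
  rewrite eqxx scale1r sfcoR_omega (bilin_sumr (bilin_sder_snoc _ i)).
  by apply: eq_bigr => q _; rewrite (bilinZr (bilin_sder_snoc _ i)).
by rewrite (negbTE ne) scale0r (bilin0l (bilin_sder_snoc _ i)).
Qed.

(** ** Covariance *)

Lemma coact_omega (psi : {scalar A}) n (x : T n) p :
  coact psi (snoc x (om p)) =
  \sum_j snoc (coact (rtrans psi (sM F j p)) x) (om j).
Proof. exact: coact_snoc (sME p). Qed.

Lemma coact_sum (psi : {scalar A}) n I (r : seq I) (P : pred I) (x : I -> T n) :
  coact psi (\sum_(i <- r | P i) x i) = \sum_(i <- r | P i) coact psi (x i).
Proof. exact: (linear_sum (@coact _ _ _ _ psi n)). Qed.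

Lemma coact_rtrans_linear (psi : {scalar A}) n (x : T n) :
  linear (fun a => coact (rtrans psi a) x).
Proof. exact: slice_rtrans_linear. Qed.

Lemma coact_rtrans2 (psi : {scalar A}) n (x : T n) a b :
  coact (rtrans (rtrans psi a) b) x = coact (rtrans psi (b * a)) x.
Proof. by apply: eq_slice => w; rewrite /rtrans mulrA. Qed.

(** Covariance of the skew derivations,
    D_m x_0 (x) x_1 = (D_k x)_0 (x) (D_k x)_1 M_m^k, with a functional applied
    to the last factor. *)
Lemma sder_coact (psi : {scalar A}) n m (x : T n.+1) :
  sder m (coact psi x) = \sum_k coact (rtrans psi (sM F m k)) (sder k x).
Proof.
elim: n psi m x => [|n IH] psi m x;
  rewrite (snoc_dec x) coact_sum sder_sum;
  (under [RHS]eq_bigr => k _ do rewrite sder_sum coact_sum);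
  rewrite exchange_big /=; apply: eq_bigr => p _; move: (lastc p x) => {}x;
  rewrite coact_omega sder_sum;
  (under [LHS]eq_bigr => j _ do rewrite sder_snoc_omega);
  (under [RHS]eq_bigr => k _ do rewrite sder_snoc_omega linearB linearZ);
  rewrite !big_split /= !sumrN; congr (_ - _).
- by rewrite (bigD1 m) //= [RHS](bigD1 p) //= !eqxx !scale1r !big1 // =>
    i /negbTE ni;
    rewrite ?ni ?scale0r // eq_sym ni scale0r.
- by rewrite !big1 // => i _; [rewrite big1 ?linear0 // =>
    j _|rewrite big1 // => j _];
    rewrite big1 // => q _; rewrite scaler0.
- by rewrite (bigD1 m) //= [RHS](bigD1 p) //= !eqxx !scale1r !big1 // =>
    i /negbTE ni;
    rewrite ?ni ?scale0r // eq_sym ni scale0r.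
(* both sides are sums over s, q of L s q at the two sides of the
   Yetter-Drinfeld relation for the entries of M *)
pose L s q a := snoc (coact (rtrans psi a) (sder s x)) (om q).
have Bs := @bilin_snoc _ _ _ G n.
have Llin s q : linear (L s q).
  exact: (linear_comp (Bs.2 (om q)) (coact_rtrans_linear psi (sder s x))).
transitivity (\sum_s \sum_q L s q
    (\sum_i \sum_j sf F i m (sM F q j) *: (sM F i s * sM F j p))).
  transitivity (\sum_s \sum_q \sum_i \sum_j
      sf F i m (sM F q j) *: L s q (sM F i s * sM F j p)); last first.
    apply: eq_bigr => s _; apply: eq_bigr => q _;
      rewrite (linear_sumE _ _ _ (Llin s q)).
    apply: eq_bigr => i _; rewrite (linear_sumE _ _ _ (Llin s q)).
    by apply: eq_bigr => j _; rewrite (linearZE _ _ (Llin s q)).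
  under eq_bigr => j _ do under eq_bigr => i _ do under eq_bigr => q _ do
    rewrite sder_snocS IH (bilin_suml Bs) scaler_sumr.
  under eq_bigr => j _ do under eq_bigr => i _ do rewrite exchange_big /=.
  under eq_bigr => j _ do rewrite exchange_big /=.
  rewrite exchange_big /=; apply: eq_bigr => s _.
  under eq_bigr => j _ do rewrite exchange_big /=.
  rewrite exchange_big /=; apply: eq_bigr => q _.
  rewrite exchange_big /=; apply: eq_bigr => i _; apply: eq_bigr => j _.
  by rewrite coact_rtrans2.
transitivity (\sum_s \sum_q \sum_k \sum_j
      sf F s k (sM F j p) *: L s q (sM F q j * sM F m k)).
  apply: eq_bigr => s _; apply: eq_bigr => q _; rewrite yetter_drinfeld_sM.
  rewrite (linear_sumE _ _ _ (Llin s q)).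
  apply: eq_bigr => i _; rewrite (linear_sumE _ _ _ (Llin s q)).
  by apply: eq_bigr => j _; rewrite (linearZE _ _ (Llin s q)).
under eq_bigr => s _ do rewrite exchange_big /=.
rewrite exchange_big /=; apply: eq_bigr => k _; rewrite coact_sum.
apply: eq_bigr => s _; rewrite exchange_big coact_sum; apply: eq_bigr => q _ /=.
rewrite linearZ /= sder_snocS coact_omega scaler_sumr; apply: eq_bigr => j _.
by rewrite coact_rtrans2.
Qed.

End SkewDerivation.

#[local] Arguments sder : simpl never.
#[local] Arguments sder_snoc : simpl never.

(** * The Cartan formula for formal differentials *)

Section TensorCartan.
Variables (K : comNzRingType) (A : algType K) (H : hopf_algebra A).
Variables (G : bicovariant_calculus H) (F : invariant_frame G).
Local Notation N := (fdim F).
Local Notation T := (tpow G).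
Local Notation d := (dif G).

(** [differential x y]: for some expression of [x] as a sum of tensors
    a db_1 (x) ... (x) db_n, [y] is the corresponding sum of tensors
    da (x) db_1 (x) ... (x) db_n.  It is a relation because [y] is determined by
    [x] only up to the kernel of [antisym]. *)
Inductive differential : forall n, T n -> T n.+1 -> Prop :=
| diff_base (a : T 0) : differential a (snoc (1 : T 0) (d a))
| diff_snoc n (x : T n) y b : differential x y ->
    differential (snoc x (d b)) (snoc y (d b))
| diff_zero n : differential (0 : T n) 0
| diff_add n (x x' : T n) y y' : differential x y -> differential x' y' ->
    differential (x + x') (y + y').

Lemma diff_scale n (x : T n) y k :
  differential x y -> differential (k *: x) (k *: y).
Proof.
elim=> {n x y} [a|n x y b _ IH|n|n x x' y y' _ IH _ IH'].
- by rewrite -(bilinZr (@bilin_snoc _ _ _ G 0)) -linearZ; apply: diff_base.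
- by rewrite -!(bilinZl (@bilin_snoc _ _ _ G _)); apply: diff_snoc.
- by rewrite !scaler0; apply: diff_zero.
- by rewrite !scalerDr; apply: diff_add.
Qed.

Lemma diff_opp n (x : T n) y : differential x y -> differential (- x) (- y).
Proof. by rewrite -!scaleN1r; apply: diff_scale. Qed.

Lemma diff_sub n (x x' : T n) y y' : differential x y -> differential x' y' ->
  differential (x - x') (y - y').
Proof. by move=> h h'; apply: diff_add => //; apply: diff_opp. Qed.

Lemma diff_sum n I (r : seq I) (x : I -> T n) y :
  (forall i, differential (x i) (y i)) ->
  differential (\sum_(i <- r) x i) (\sum_(i <- r) y i).
Proof.
move=> h; elim/big_rec2: _ => [|i y' x' _ h']; first exact: diff_zero.
exact: diff_add.
Qed.

(** The Leibniz rule d(x c) = (dx) c + (-1)^n x (x) dc. *)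
Lemma diff_ract n (x : T n) y c : differential x y ->
  differential (x ⊲ c) (y ⊲ c + (-1) ^+ n *: snoc x (d c)).
Proof.
have Bs m := @bilin_snoc _ _ _ G m.
move=> h; elim: h c => {n x y} [a|n x y b h IH|n|n x x' y y' _ IH _ IH'] c.
- rewrite scale1r ract_snoc -[a in X in _ + snoc X _]mul1r.
  rewrite -[snoc (1 * a : T 0) _]/(snoc ((1 : T 0) ⊲ a) (d c)) snoc_bal.
  by rewrite -(bilinDr (Bs _)) -difM; apply: diff_base.
- rewrite !ract_snoc.
  have -> : d b ⊲ c = d (b * c) - b ⊳ d c by rewrite difM addrK.
  rewrite !(bilinDr (Bs _)) !(bilinNr (Bs _)) -!snoc_bal.
  have -> : snoc y (d (b * c)) - snoc (y ⊲ b) (d c) +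
      (-1) ^+ n.+1 *: snoc (snoc x (d b)) (d c) =
      snoc y (d (b * c)) - snoc (y ⊲ b + (-1) ^+ n *: snoc x (d b)) (d c).
    rewrite (bilinDl (Bs _)) (bilinZl (Bs _)) opprD addrA exprS mulN1r.
    by rewrite scaleNr.
  by apply: diff_sub; apply: diff_snoc.
- by rewrite !linear0 (bilin0l (Bs _)) scaler0 addr0; apply: diff_zero.
- rewrite !linearD (bilinDl (Bs _)) scalerDr addrACA.
  exact: diff_add.
Qed.

(** [z] is a differential of [(-1)^(n-1) D_l x], a tensor whose form is the
    contraction of the form of [x] with [t_l]; in degree zero, [z] is zero. *)
Definition diff_contract n (l : 'I_N) : T n -> T n -> Prop :=
  match n return T n -> T n -> Prop with
  | 0 => fun _ z => z = 0
  | m.+1 => fun x z => differential ((-1) ^+ m *: sder l x) z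
  end.

Lemma diff_contract_snoc n l (x z : T n) b : diff_contract l x z ->
  differential ((-1) ^+ n.+1 *: sder_snoc l x (d b)) (snoc z (d b)).
Proof.
case: n x z => [|n] x z /= h.
  by rewrite h scaler0 (bilin0l (@bilin_snoc _ _ _ G _)); apply: diff_zero.
rewrite !exprS mulN1r mulN1r opprK sder_snocS -(bilinZl (@bilin_snoc _ _ _ G
  _)).
exact: diff_snoc.
Qed.

(** The Lie derivative as a twisted derivation, from [chi_mul]. *)
Lemma chi_coact n l (x : T n) b :
  coact (chi F l) (snoc x (d b)) =
  \sum_k snoc (coact (chi F k) x) (d (conv H (sf F k l) b)) +
  snoc x (d (conv H (chi F l) b)).
Proof.
pose phi (o : option 'I_N) : {scalar A} :=
  if o is Some k then chi F k else counit H.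
pose theta (o : option 'I_N) : {scalar A} :=
  if o is Some k then sf F k l else chi F l.
pose r := None :: [seq Some k | k <- index_enum 'I_N].
rewrite (@coact_mul _ _ _ _ _ _ r phi theta); last first.
  by move=> u v; rewrite chi_mul big_cons big_map addrC.
rewrite big_cons big_map /= coact_counit slice_coR_dif addrC; congr (_ + _).
by apply: eq_bigr => k _; rewrite slice_coR_dif.
Qed.

(** The Cartan formula on tensors, before any antisymmetrization. *)
Lemma cartan_tensor n (x : T n) y l : differential x y ->
  exists2 z, diff_contract l x z &
    coact (chi F l) x = (-1) ^+ n *: sder l y + z.
Proof.
have Bs m := @bilin_snoc _ _ _ G m.
move=> h; elim: h l => {n x y} [a|n x y b h IH|n|n x x' y y' _ IH _ IH'] l.
- exists 0 => //; rewrite scale1r addr0 sder_snoc_dif big1 ?subr0 => [|i _ //].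
  by rewrite -[coact _ _]/(conv H (chi F l) a) -[LHS]mul1r.
- pose c := conv H (chi F l) b; pose e i := conv H (sf F i l) b.
  have [z Hz ez] : exists2 z : 'I_N -> T n, forall i, diff_contract i x (z i) &
      forall i, coact (chi F i) x = (-1) ^+ n *: sder i y + z i.
    by exists (fun i => s2val (cid2 (IH i))) => i; case: cid2.
  (* by [sder_snoc_dif], D_l (x (x) db) is x c minus the D_i x (x) d (e i) *)
  exists ((-1) ^+ n *: (y ⊲ c + (-1) ^+ n *: snoc x (d c)) +
          \sum_i snoc (z i) (d (e i))).
    rewrite /diff_contract sder_snoc_dif scalerBr scaler_sumr -sumrN.
    apply: diff_add; first by apply: diff_scale; apply: diff_ract.
    apply: diff_sum => i; rewrite -scaleNr.
    have -> : - (-1) ^+ n = (-1) ^+ n.+1 :> K by rewrite exprS mulN1r.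
    exact: diff_contract_snoc.
  rewrite chi_coact sder_snoc_dif scalerBr scalerDr scalerA -exprMn mulrNN
    mulr1 expr1n.
  rewrite scale1r exprS mulN1r !scaleNr opprK addrA.
  set S1 := \sum_i snoc (coact _ _) _; set S2 := \sum_i sder_snoc _ _ _.
  have -> : S1 = (-1) ^+ n *: S2 + \sum_i snoc (z i) (d (e i)).
    rewrite scaler_sumr -big_split; apply: eq_bigr => i _ /=.
    by rewrite ez (bilinDl (Bs _)) (bilinZl (Bs _)) sder_snocS.
  by rewrite [in RHS](addrC (- _)) addrA subrK addrAC.
- exists 0; last by rewrite !linear0 addr0.
  case: n => [|n] //=; by rewrite !linear0; apply: diff_zero.
- have [z Hz ez] := IH l; have [z' Hz' ez'] := IH' l.
  exists (z + z'); last by rewrite !linearD /= ez ez' addrACA.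
  clear IH IH' ez ez'.
  case: n x x' y y' z z' Hz Hz' => [|n] x x' _ _ z z' /= Hz Hz'.
    by rewrite Hz Hz' addr0.
  by rewrite !linearD; apply: diff_add.
Qed.
End TensorCartan.

(** * Coordinates and the antisymmetrizers *)

(** ** Multi-indices *)

Section Families.
Variables (X : Type) (n : nat).
Implicit Types (I : {ffun 'I_n -> X}) (J : {ffun 'I_n.+1 -> X}) (k : X).

(** The family [I] followed by [k], and a family without its last entry. *)
Definition ffsnoc I k : {ffun 'I_n.+1 -> X} :=
  [ffun i => oapp I k (unlift ord_max i)].
Definition ffront J : {ffun 'I_n -> X} := [ffun k => front J k].

Lemma widen_lift (r : 'I_n) : widen_ord (leqnSn n) r = lift ord_max r.
Proof. by apply: val_inj; rewrite [RHS]lift_max. Qed.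

Lemma ffsnoc_last I k : ffsnoc I k ord_max = k.
Proof. by rewrite ffunE unlift_none. Qed.

Lemma ffsnoc_lift I k r : ffsnoc I k (lift ord_max r) = I r.
Proof. by rewrite ffunE liftK. Qed.

Lemma front_ffsnoc I k : front (ffsnoc I k) =1 I.
Proof. by move=> r; rewrite /front widen_lift ffsnoc_lift. Qed.

Lemma ffront_ffsnoc I k : ffront (ffsnoc I k) = I.
Proof. by apply/ffunP => r; rewrite ffunE front_ffsnoc. Qed.

Lemma ffsnoc_ffront J : ffsnoc (ffront J) (J ord_max) = J.
Proof.
apply/ffunP => r; rewrite ffunE; case: unliftP => [j ->|->] //=.
by rewrite ffunE /front widen_lift.
Qed.

End Families.

(** ** Coefficients and matrices *)

Section Coordinates.
Variables (K : comNzRingType) (A : algType K) (H : hopf_algebra A).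
Variables (G : bicovariant_calculus H) (F : invariant_frame G).
Local Notation N := (fdim F).
Local Notation T := (tpow G).
Local Notation d := (dif G).
Local Notation om := (omega F).
Local Notation midx n := {ffun 'I_n -> 'I_N}.
Local Notation mmx n := 'M[K]_(#|{: midx n}|).

Lemma sum_ffsnoc (V : nmodType) n (E : midx n.+1 -> V) :
  \sum_J E J = \sum_I \sum_k E (ffsnoc I k).
Proof.
rewrite pair_big /=.
rewrite (reindex (fun p : midx n * 'I_N => ffsnoc p.1 p.2)) //=.
exists (fun J => (ffront J, J ord_max)) => [[I k]|J] _ /=.
  by rewrite ffront_ffsnoc ffsnoc_last.
exact: ffsnoc_ffront.
Qed.

Lemma eq_ffsnoc n (I J : midx n) k l : (ffsnoc I k == ffsnoc J l) =
  (I == J) && (k == l).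
Proof.
apply/eqP/andP => [e|[/eqP -> /eqP -> //]].
by rewrite -(ffront_ffsnoc I k) -{2}(ffsnoc_last I k)
  e ffront_ffsnoc ffsnoc_last !eqxx.
Qed.

Lemma ptens_snoc n (rho : 'I_n.+1 -> G) :
  ptens rho = snoc (ptens (front rho)) (rho ord_max).
Proof. by []. Qed.

Lemma eq_ptens n (rho rho' : 'I_n -> G) : rho =1 rho' -> ptens rho = ptens rho'.
Proof. by move=> /funext ->. Qed.

Lemma otens_ffsnoc n (I : midx n) k : otens (ffsnoc I k) =
  snoc (otens I) (om k).
Proof.
rewrite /otens ptens_snoc ffsnoc_last; congr snoc; apply: eq_ptens => r.
by rewrite -[front _ _]/(om (front (ffsnoc I k) r)) front_ffsnoc.
Qed.

Lemma otens_span n (x : T n) :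
  exists c : {ffun midx n -> A}, x = \sum_I c I ⊳ otens I.
Proof.
elim: n x => [|n IH] x.
  exists [ffun=> x]; rewrite (big_pred1 [ffun k : 'I_0 =>
    False_rect 'I_N (notF (ltn_ord k))]) => [|I /=].
    by rewrite ffunE; exact: (esym (mulr1 (x : A))).
  by apply/esym/eqP/ffunP => - [].
have [c Hc] : exists c : 'I_N -> {ffun midx n -> A},
    forall k, lastc k x = \sum_I c k I ⊳ otens I.
  exists (fun k => sval (cid (IH (lastc k x)))) => k; by case: cid.
exists [ffun J : midx n.+1 => c (J ord_max) (ffront J)].
rewrite [LHS](snoc_dec F) sum_ffsnoc exchange_big; apply: eq_bigr => k _.
rewrite Hc (bilin_suml (@bilin_snoc _ _ _ _ _)); apply: eq_bigr => I _.
by rewrite ffunE ffsnoc_last ffront_ffsnoc otens_ffsnoc lact_snoc.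
Qed.

Lemma otens_free n (c c' : midx n -> A) :
  \sum_I c I ⊳ otens I = \sum_I c' I ⊳ otens I -> c =1 c'.
Proof.
elim: n c c' => [|n IH] c c'.
  move=> e I; move: e; rewrite !(big_pred1 I) => [|J /=|J /=]; last 2 first.
  - by apply/esym/eqP/ffunP => - [].
  - by apply/esym/eqP/ffunP => - [].
  by move=> e; rewrite -[c I]mulr1 -[c' I]mulr1.
have P (b : midx n.+1 -> A) k :
    lastc k (\sum_J b J ⊳ otens J) = \sum_I b (ffsnoc I k) ⊳ otens I.
  rewrite -[RHS](lastc_sum k (fun j => \sum_I b (ffsnoc I j) ⊳ otens I)).
  congr (lastc k _); rewrite sum_ffsnoc exchange_big; apply: eq_bigr => j _.
  rewrite (bilin_suml (@bilin_snoc _ _ _ _ _)); apply: eq_bigr => I _.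
  by rewrite otens_ffsnoc lact_snoc.
move=> e J; rewrite -(ffsnoc_ffront J).
by apply: (IH (fun I => c (ffsnoc I _)) (fun I => c' (ffsnoc I _)));
  rewrite -!P e.
Qed.

Lemma coefE n (x : T n) : x = \sum_I coef F x I ⊳ otens I.
Proof. exact: (xgetPex 0 (otens_span x)). Qed.

Lemma coef_uniq n (x : T n) (c : midx n -> A) :
  x = \sum_I c I ⊳ otens I -> coef F x =1 c.
Proof. by rewrite {1}(coefE x); apply: otens_free. Qed.

Lemma coef_linear n I : linear (fun x : T n => coef F x I).
Proof.
move=> k x y; apply: (coef_uniq (c := fun I => k *: coef F x I + coef F y I)).
rewrite [in LHS](coefE x) [in LHS](coefE y) scaler_sumr -big_split.
apply: eq_bigr => J _ /=.
by rewrite (bilinDl (@bilin_lact _ _ _)) (bilinZl (@bilin_lact _ _ _)).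
Qed.

Lemma coef_lact n a (x : T n) I : coef F (a ⊳ x) I = a * coef F x I.
Proof.
apply: (coef_uniq (c := fun I => a * coef F x I)).
rewrite [in LHS](coefE x) (bilin_sumr (@bilin_lact _ _ _)).
by apply: eq_bigr => J _; rewrite lactM.
Qed.

Lemma coef_otens n (I J : midx n) : coef F (otens I) J = (I == J)%:R.
Proof.
apply: (coef_uniq (c := fun J => (I == J)%:R)).
rewrite (bigD1 I) //= eqxx lact1 big1 ?addr0 // => L /negbTE ne.
by rewrite eq_sym ne (bilin0l (@bilin_lact _ _ _)).
Qed.

Lemma coef_lastc n (x : T n.+1) I k : coef F x (ffsnoc I k) =
  coef F (lastc k x) I.
Proof.
rewrite -[ffsnoc I k in LHS]/(ffsnoc I k); move: I k.
suff h : coef F x =1 fun J : midx n.+1 =>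
  coef F (lastc (J ord_max) x) (ffront J).
  by move=> I k; rewrite h ffsnoc_last ffront_ffsnoc.
apply: coef_uniq; rewrite [LHS](snoc_dec F) sum_ffsnoc exchange_big;
  apply: eq_bigr => k _.
rewrite {1}[lastc k x]coefE (bilin_suml (@bilin_snoc _ _ _ _ _));
  apply: eq_bigr => I _.
by rewrite ffsnoc_last ffront_ffsnoc otens_ffsnoc lact_snoc.
Qed.

Lemma otens_ext n m (g h : T n -> T m) : linear g -> linear h ->
  (forall a x, g (a ⊳ x) = a ⊳ g x) -> (forall a x, h (a ⊳ x) = a ⊳ h x) ->
  (forall I : midx n, g (otens I) = h (otens I)) -> g =1 h.
Proof.
move=> lg lh ag ah e x; rewrite (coefE x) !linear_sumE //.
by apply: eq_bigr => I _; rewrite ag ah e.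
Qed.

(** The left linear map [omega^I |-> X^I_J omega^J]. *)
Definition mxop n (X : mmx n) (x : T n) : T n :=
  \sum_(I : midx n) \sum_(J : midx n)
    mentry X I J *: (coef F x I ⊳ otens J).

Lemma antisymE n (x : T n) : antisym F x = mxop (W F n) x.
Proof. by []. Qed.

Lemma mxop_linear n (X : mmx n) : linear (mxop X).
Proof.
move=> k x y; rewrite /mxop scaler_sumr -big_split; apply: eq_bigr => I _ /=.
rewrite scaler_sumr -big_split; apply: eq_bigr => J _ /=.
rewrite coef_linear (bilinDl (@bilin_lact _ _ _)) (bilinZl (@bilin_lact _ _ _)).
by rewrite scalerDr !scalerA mulrC.
Qed.

HB.instance Definition _ n (X : mmx n) :=
  GRing.isLinear.Build K _ _ _ (mxop X) (mxop_linear X).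

Lemma mxop_sum n (X : mmx n) I (r : seq I) (P : pred I) (x : I -> T n) :
  mxop X (\sum_(i <- r | P i) x i) = \sum_(i <- r | P i) mxop X (x i).
Proof. exact: (linear_sum (mxop X)). Qed.

Lemma mxop_lact n (X : mmx n) a x : mxop X (a ⊳ x) = a ⊳ mxop X x.
Proof.
rewrite /mxop (bilin_sumr (@bilin_lact _ _ _)); apply: eq_bigr => I _.
rewrite (bilin_sumr (@bilin_lact _ _ _)); apply: eq_bigr => J _.
by rewrite coef_lact lactM (bilinZr (@bilin_lact _ _ _)).
Qed.

Lemma mxop_otens n (X : mmx n) (I : midx n) :
  mxop X (otens I) = \sum_J mentry X I J *: otens J.
Proof.
rewrite /mxop (bigD1 I) //= [X in _ + X]big1 ?addr0 => [|L /negbTE ne].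
  by apply: eq_bigr => J _; rewrite coef_otens eqxx lact1.
rewrite big1 // => J _.
by rewrite coef_otens eq_sym ne (bilin0l (@bilin_lact _ _ _)) scaler0.
Qed.

Lemma mentry_mmatrix n (E : midx n -> midx n -> K) I J :
  mentry (mmatrix E) I J = E I J.
Proof. by rewrite /mentry mxE !enum_rankK. Qed.

Lemma mentry_mul n (X Y : mmx n) I J :
  mentry (X *m Y) I J = \sum_L mentry X I L * mentry Y L J.
Proof.
rewrite /mentry mxE (reindex (@enum_rank {ffun 'I_n -> 'I_N})) //.
by apply: onW_bij; apply: enum_rank_bij.
Qed.

Lemma mxopM n (X Y : mmx n) x : mxop (X *m Y) x = mxop Y (mxop X x).
Proof.
move: x; apply: otens_ext => [||a x|a x|I]; try exact: mxop_linear.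
- by apply: linear_comp; apply: mxop_linear.
- exact: mxop_lact.
- by rewrite !mxop_lact.
rewrite !mxop_otens linear_sum /=.
under [RHS]eq_bigr => L _ do rewrite linearZ /= mxop_otens scaler_sumr.
rewrite exchange_big; apply: eq_bigr => J _ /=.
rewrite mentry_mul scaler_suml; apply: eq_bigr => L _.
by rewrite scalerA.
Qed.

Lemma mxop1 n (x : T n) : mxop 1 x = x.
Proof.
move: x; apply: otens_ext => [||a x|//|I];
  [exact: mxop_linear|by []|exact: mxop_lact|].
rewrite mxop_otens (bigD1 I) //= big1 ?addr0 => [|J ne].
  by rewrite /mentry mxE eqxx scale1r.
by rewrite /mentry mxE (inj_eq enum_rank_inj) eq_sym (negbTE ne) scale0r.
Qed.

Lemma mxopB n (X Y : mmx n) x : mxop (X - Y) x = mxop X x - mxop Y x.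
Proof.
rewrite /mxop -sumrB; apply: eq_bigr => I _; rewrite -sumrB.
by apply: eq_bigr => J _; rewrite /mentry !mxE scalerBl.
Qed.

Lemma mentryP n (X Y : mmx n) :
  (forall I J, mentry X I J = mentry Y I J) -> X = Y.
Proof.
move=> e; apply/matrixP => p q.
by have := e (enum_val p) (enum_val q); rewrite /mentry !enum_valK.
Qed.

(** The matrix [X] acting on the first n of n+1 factors. *)
Definition mxext n (X : mmx n) : mmx n.+1 :=
  mmatrix (fun I J => mentry X (ffront I) (ffront J)
    * (I ord_max == J ord_max)%:R).

Lemma mentry_mxext n (X : mmx n) I J k l :
  mentry (mxext X) (ffsnoc I k) (ffsnoc J l) = mentry X I J * (k == l)%:R.
Proof. by rewrite mentry_mmatrix !ffront_ffsnoc !ffsnoc_last. Qed.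

Lemma mentry_ffsnocP n (X Y : mmx n.+1) :
  (forall I J k l, mentry X (ffsnoc I k) (ffsnoc J l) =
    mentry Y (ffsnoc I k) (ffsnoc J l)) -> X = Y.
Proof.
by move=> e; apply: mentryP => I J; rewrite -(ffsnoc_ffront I)
  -(ffsnoc_ffront J).
Qed.

Lemma mentry1 n (I J : midx n) : mentry 1 I J = (I == J)%:R.
Proof. by rewrite /mentry mxE (inj_eq enum_rank_inj). Qed.

Lemma mxext1 n : mxext (1 : mmx n) = 1.
Proof.
apply: mentry_ffsnocP => I J k l.
by rewrite mentry_mxext !mentry1 eq_ffsnoc -natrM mulnb.
Qed.

Lemma mxextM n (X Y : mmx n) : mxext (X *m Y) = mxext X *m mxext Y.
Proof.
apply: mentry_ffsnocP => I J k l; rewrite mentry_mxext !mentry_mul sum_ffsnoc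
  mulr_suml.
apply: eq_bigr => L _; rewrite (bigD1 l) //= big1 ?addr0 => [|m ne].
  by rewrite !mentry_mxext eqxx mulr1 mulrAC.
by rewrite !mentry_mxext (negbTE ne) !mulr0.
Qed.

Lemma mentryD n (X Y : mmx n) I J :
  mentry (X + Y) I J = mentry X I J + mentry Y I J.
Proof. exact: mxE. Qed.

Lemma mentryZ n a (X : mmx n) I J : mentry (a *: X) I J = a * mentry X I J.
Proof. exact: mxE. Qed.

Lemma mxextD n (X Y : mmx n) : mxext (X + Y) = mxext X + mxext Y.
Proof.
apply: mentry_ffsnocP => I J k l.
by rewrite mentryD !mentry_mxext mentryD mulrDl.
Qed.

Lemma mxextZ n a (X : mmx n) : mxext (a *: X) = a *: mxext X.
Proof.
apply: mentry_ffsnocP => I J k l.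
by rewrite mentryZ !mentry_mxext mentryZ mulrA.
Qed.

Lemma mxop_ext n (X : mmx n) x k :
  mxop (mxext X) (snoc x (om k)) = snoc (mxop X x) (om k).
Proof.
have Bs := @bilin_snoc _ _ _ G n.
move: x; apply: otens_ext => [||a x|a x|I].
- exact: (linear_comp (mxop_linear _) (Bs.2 _)).
- exact: (linear_comp (Bs.2 _) (mxop_linear _)).
- by rewrite -lact_snoc mxop_lact.
- by rewrite mxop_lact -lact_snoc.
rewrite -otens_ffsnoc !mxop_otens (bilin_suml Bs) sum_ffsnoc;
  apply: eq_bigr => J _.
rewrite (bigD1 k) //= big1 ?addr0 => [|l ne].
  by rewrite mentry_mxext eqxx mulr1 otens_ffsnoc (bilinZl Bs).
by rewrite mentry_mxext eq_sym (negbTE ne) mulr0 scale0r.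
Qed.

(** ** The recursion for the antisymmetrizers *)

Lemma inord_lift n r : (r <= n)%N ->
  inord r = lift ord_max (inord r : 'I_n.+1) :> 'I_n.+2.
Proof.
by move=> h; apply: val_inj; rewrite [RHS]lift_max /= !inordK // ltnS // ltnW.
Qed.

Lemma inord_max n : inord n = ord_max :> 'I_n.+1.
Proof. by apply: val_inj; rewrite /= inordK. Qed.

Lemma prod_eq n (I J : midx n) : \prod_r (I r == J r)%:R = (I == J)%:R :> K.
Proof.
case: eqP => [->|ne]; first by rewrite big1 // => r _; rewrite eqxx.
have [r nr] : exists r, I r != J r.
  apply: contrapT => h; apply: ne; apply/ffunP => r.
  by apply/eqP/negPn/negP => nr; apply: h; exists r.
by rewrite (bigD1 r) //= (negbTE nr) mul0r.
Qed.

Lemma Lambda_at_ext n m : (0 < m <= n)%N ->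
  Lambda_at F n.+1 m = mxext (Lambda_at F n m).
Proof.
case/andP=> m0 mn; apply: mentry_ffsnocP => I J k l.
rewrite mentry_mxext !mentry_mmatrix !inord_lift //; last first.
  by rewrite (leq_trans (leq_pred m)).
rewrite !ffsnoc_lift -mulrA; congr (_ * _).
rewrite big_mkcond big_ord_recr /= !ffsnoc_last !neq_lift /= [in RHS]big_mkcond.
congr (_ * _); apply: eq_bigr => r _.
by rewrite widen_lift !ffsnoc_lift !(inj_eq (@lift_inj _ ord_max)).
Qed.

Lemma Lambda_last n (I J : midx n) i k m l :
  mentry (Lambda_at F n.+1 n.+1)
    (ffsnoc (ffsnoc I i) k) (ffsnoc (ffsnoc J m) l) =
  Lambda i k m l * (I == J)%:R.
Proof.
rewrite mentry_mmatrix /= inord_max inord_lift // inord_max !ffsnoc_last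
  !ffsnoc_lift !ffsnoc_last.
congr (_ * _); rewrite big_mkcond big_ord_recr big_ord_recr /=.
rewrite !widen_lift !eqxx /= andbF !mulr1 -prod_eq.
apply: eq_bigr => r _.
rewrite !widen_lift !ffsnoc_lift (inj_eq (@lift_inj _ ord_max)).
by rewrite !(eq_sym (lift _ _)) !neq_lift.
Qed.

Lemma mxop_Lambda n (u : T n) i k :
  mxop (Lambda_at F n.+1 n.+1) (snoc (snoc u (om i)) (om k)) =
  \sum_l \sum_q Lambda i k q l *: snoc (snoc u (om q)) (om l).
Proof.
have Bs m := @bilin_snoc _ _ _ G m.
have lin j p : linear (fun u : T n => snoc (snoc u (om j)) (om p)).
  exact: (linear_comp ((Bs _).2 _) ((Bs _).2 _)).
move: u; apply: otens_ext => [||a x|a x|I].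
- exact: (linear_comp (mxop_linear _) (lin _ _)).
- move=> c x y; rewrite scaler_sumr -big_split; apply: eq_bigr => l _ /=.
  rewrite scaler_sumr -big_split; apply: eq_bigr => q _ /=.
  by rewrite lin scalerDr !scalerA mulrC.
- by rewrite -!lact_snoc mxop_lact.
- rewrite (bilin_sumr (@bilin_lact _ _ _)); apply: eq_bigr => l _.
  rewrite (bilin_sumr (@bilin_lact _ _ _)); apply: eq_bigr => q _.
  by rewrite -!lact_snoc (bilinZr (@bilin_lact _ _ _)).
rewrite -!otens_ffsnoc mxop_otens sum_ffsnoc exchange_big;
  apply: eq_bigr => l _ /=.
rewrite sum_ffsnoc exchange_big; apply: eq_bigr => q _ /=.
rewrite (bigD1 I) //= big1 ?addr0 => [|J ne].
  by rewrite Lambda_last eqxx mulr1 !otens_ffsnoc.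
by rewrite Lambda_last eq_sym (negbTE ne) mulr0 scale0r.
Qed.

Lemma shuffleE n : shuffle F n =
  \sum_(0 <= k < n.+1) (-1) ^+ k *:
    \prod_(n.+1 - k <= m < n.+1) Lambda_at F n m.
Proof. by rewrite /shuffle [RHS]big_ltn // scale1r subn0 big_geq. Qed.

Lemma shuffle_rec n :
  shuffle F n.+1 = 1 - mxext (shuffle F n) *m Lambda_at F n.+1 n.+1.
Proof.
rewrite {1}/shuffle; congr (_ + _); rewrite big_add1 /= shuffleE.
rewrite (big_morph (@mxext _) (@mxextD _) (id1 := 0)); last first.
  by apply: mentry_ffsnocP => I J k l; rewrite mentry_mxext /mentry !mxE mul0r.
rewrite mulmx_suml -sumrN; apply: eq_big_nat => k /andP[_ kn].
rewrite mxextZ -scalemxAl exprS mulN1r scaleNr; congr (- (_ *: _)).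
rewrite subSS big_nat_recr /= ?leq_subr //; congr (_ * _).
rewrite (big_morph (@mxext _) (@mxextM _) (@mxext1 _)).
apply: eq_big_nat => m /andP[m1 m2]; apply: Lambda_at_ext.
by apply/andP; split=> //; rewrite (leq_trans _ m1) // subn_gt0.
Qed.

(** The shuffle matrix splits off the last factor by the skew derivations. *)
Lemma mxop_shuffle n (x : T n.+1) :
  mxop (shuffle F n) x = \sum_l snoc (sder l x) (om l).
Proof.
have Bs m := @bilin_snoc _ _ _ G m.
elim: n x => [|n IH] x.
  rewrite /shuffle big_geq // addr0 mxop1 [LHS](snoc_dec F).
  apply: eq_bigr => l _; rewrite sderE big1 ?subr0 // => i _.
  by rewrite big1.
rewrite shuffle_rec mxopB mxop1 mxopM (snoc_dec F x).
rewrite (mxop_sum (mxext _)) mxop_sum.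
under [RHS]eq_bigr => l _ do rewrite sder_sum (bilin_suml (Bs _)).
rewrite -sumrB exchange_big; apply: eq_bigr => k _; move: (lastc k x) => y.
rewrite mxop_ext IH (bilin_suml (Bs _)) mxop_sum.
under [X in _ - X]eq_bigr => i _ do rewrite mxop_Lambda.
under [RHS]eq_bigr => l _ do rewrite sder_snoc_omega (bilinDl (Bs _))
  (bilinNl (Bs _)).
rewrite sumrB; congr (_ - _).
  rewrite (bigD1 k) //= big1 ?addr0 ?eqxx ?scale1r // => l ne.
  by rewrite (negbTE ne) scale0r (bilin0l (Bs _)).
rewrite exchange_big; apply: eq_bigr => l _.
rewrite (bilin_suml (Bs _)); apply: eq_bigr => i _.
rewrite (bilin_suml (Bs _)); apply: eq_bigr => q _.
by rewrite (bilinZl (Bs _)) sder_snocS.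
Qed.

Lemma antisym0 (x : T 0) : antisym F x = x.
Proof. exact: mxop1. Qed.

Lemma antisym_rec n (x : T n.+1) :
  antisym F x = \sum_l snoc (antisym F (sder l x)) (om l).
Proof.
rewrite [LHS]antisymE -[W F n.+1]/(shuffle F n *m mxext (W F n))
  mxopM mxop_shuffle.
rewrite mxop_sum.
by apply: eq_bigr => l _; rewrite mxop_ext.
Qed.

Lemma antisym_linear n : linear (@antisym _ _ _ _ F n).
Proof. exact: mxop_linear. Qed.

HB.instance Definition _ n :=
  GRing.isLinear.Build K _ _ _ (@antisym _ _ _ _ F n) (@antisym_linear n).

Lemma antisym_lact n a (x : T n) : antisym F (a ⊳ x) = a ⊳ antisym F x.
Proof. exact: mxop_lact. Qed.

Lemma contractE n (j : 'I_N) (x : T n.+1) :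
  contract j x = (-1) ^+ n *: lastc j x.
Proof.
congr (_ *: _); rewrite [RHS]coefE big_mkcond sum_ffsnoc; apply: eq_bigr => I _.
rewrite (bigD1 j) //= ffsnoc_last eqxx big1 ?addr0 => [|k ne].
  rewrite coef_lastc; congr (_ ⊳ _); apply: eq_ptens => r.
  by rewrite -[LHS]/(om (front (ffsnoc I j) r)) front_ffsnoc.
by rewrite ffsnoc_last (negbTE ne).
Qed.

Lemma contract_antisym n (j : 'I_N) (x : T n.+1) :
  contract j (antisym F x) = (-1) ^+ n *: antisym F (sder j x).
Proof. by rewrite contractE antisym_rec lastc_sum. Qed.

Lemma coact_antisym (psi : {scalar A}) n (x : T n) :
  coact psi (antisym F x) = antisym F (coact psi x).
Proof.
elim: n psi x => [|n IH] psi x; first by rewrite !antisym0.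
have Bs m := @bilin_snoc _ _ _ G m.
rewrite !antisym_rec coact_sum.
under [LHS]eq_bigr => k _ do rewrite coact_omega.
rewrite exchange_big; apply: eq_bigr => m _.
rewrite sder_coact (linear_sumE _ _ _ (@antisym_linear _)) (bilin_suml (Bs _)).
by apply: eq_bigr => k _; rewrite IH.
Qed.

End Coordinates.

(** * The exterior differential *)

Section Exterior.
Variables (K : comNzRingType) (A : algType K) (H : hopf_algebra A).
Variables (G : bicovariant_calculus H) (F : invariant_frame G).
Local Notation N := (fdim F).
Local Notation T := (tpow G).
Local Notation d := (dif G).
Local Notation word n := (A * {ffun 'I_n -> A})%type.

(** A word (a, b) stands for a db_1 (x) ... (x) db_n; [wordt_d] is its
    differential da (x) db_1 (x) ... (x) db_n. *)
Definition wordt n (p : word n) : T n := p.1 ⊳ ptens (fun k => d (p.2 k)).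
Definition wordt_d n (p : word n) : T n.+1 :=
  ptens (fcons (d p.1) (fun k => d (p.2 k))).

Lemma drepE n (s : seq (word n)) : drep F s = antisym F (\sum_(p <- s) wordt p).
Proof.
rewrite (linear_sumE _ _ _ (@antisym_linear _ _ _ _ F _));
  apply: eq_bigr => p _.
by rewrite antisym_lact.
Qed.

Lemma drep_dE n (s : seq (word n)) :
  drep_d F s = antisym F (\sum_(p <- s) wordt_d p).
Proof. by rewrite (linear_sumE _ _ _ (@antisym_linear _ _ _ _ F _)). Qed.

Lemma front_fcons X n (x : X) (g : 'I_n.+1 -> X) :
  front (fcons x g) =1 fcons x (front g).
Proof.
move=> r; rewrite /front /fcons; case: (unliftP ord0 r) => [j ->|->] /=.
  have -> : widen_ord (leqnSn n.+1) (lift ord0 j) =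
    lift ord0 (widen_ord (leqnSn n) j).
    exact: val_inj.
  by rewrite liftK.
have -> : widen_ord (leqnSn n.+1) ord0 = ord0 by exact: val_inj.
by rewrite unlift_none.
Qed.

Lemma fcons_last X n (x : X) (g : 'I_n.+1 -> X) : fcons x g ord_max = g ord_max.
Proof.
have -> : ord_max = lift ord0 (ord_max : 'I_n.+1) by exact: val_inj.
by rewrite /fcons liftK.
Qed.

Lemma fcons_last0 X (x : X) (g : 'I_0 -> X) : fcons x g ord_max = x.
Proof.
have -> : ord_max = ord0 :> 'I_1 by exact: val_inj.
by rewrite /fcons unlift_none.
Qed.

Lemma diff_word n (p : word n) : differential (wordt p) (wordt_d p).
Proof.
case: p => a b; rewrite /wordt /wordt_d.
suff h (c : 'I_n -> A) : differential (a ⊳ (ptens (fun k => d (c k)) : T n))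
    (ptens (fcons (d a) (fun k => d (c k)))) by exact: (h b).
elim: n {b} c => [|n IH] b.
  rewrite ptens_snoc fcons_last0.
  have -> : a ⊳ (ptens (fun k => d (b k)) : T 0) = a by exact: mulr1.
  exact: diff_base.
rewrite (ptens_snoc (fun k => d (b k))) (ptens_snoc (fcons _ _)).
rewrite fcons_last lact_snoc.
rewrite (eq_ptens (front_fcons (d a) (fun k => d (b k)))).
exact: diff_snoc (IH (front b)).
Qed.

Lemma word_span n (x : T n) :
  exists s : seq (word n), x = \sum_(p <- s) wordt p.
Proof.
elim: n x => [|n IH] x.
  by exists [:: (x : A, [ffun=> 0])]; rewrite big_seq1;
    exact: (esym (mulr1 (x : A))).
have Bs := @bilin_snoc _ _ _ G n.
elim/snoc_ind: x => [|x y [s ->] [t ->]|x rho].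
- by exists [::]; rewrite big_nil.
- by exists (s ++ t); rewrite big_cat.
elim/forms_ind: rho => [|r r' [s e] [t e']|a b].
- by exists [::]; rewrite big_nil (bilin0r Bs).
- by exists (s ++ t); rewrite big_cat (bilinDr Bs) e e'.
rewrite -snoc_bal; have [s ->] := IH (x ⊲ a).
exists [seq (p.1, ffsnoc p.2 b) | p <- s].
rewrite big_map (bilin_suml Bs); apply: eq_bigr => p _.
rewrite /wordt ptens_snoc /= ffsnoc_last -lact_snoc; congr (_ ⊳ snoc _ _).
by apply: eq_ptens => r; rewrite -[RHS]/(d (front (ffsnoc p.2 b) r))
  front_ffsnoc.
Qed.

(** The differential descends to exterior forms: by the Cartan formula and
    induction on the degree, all contractions of dx vanish if x does. *)
Lemma diff_antisym0 n (x : T n) y :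
  differential x y -> antisym F x = 0 -> antisym F y = 0.
Proof.
elim: n x y => [|n IH] x y h x0.
  have {}h : y = snoc (1 : T 0) (d (x : A)).
    (* inversion of [differential] in degree zero *)
    move: h; pose P n : T n -> T n.+1 -> Prop :=
      if n is 0 then fun x y => y = snoc (1 : T 0) (d (x : A)) else fun _ _ =>
        True.
    suff Pd m (u : T m) v : differential u v -> P m u v by exact: Pd.
    have Bs := @bilin_snoc _ _ _ G 0.
    elim=> {m u v} [a|m u v b|m|m u u' v v' _ + _] //.
      by case: m => //=; rewrite linear0 (bilin0r Bs).
    by case: m u u' v v' => //= u u' v v' -> ->; rewrite linearD (bilinDr Bs).
  rewrite antisym0 in x0.
  by rewrite h x0 linear0 (bilin0r (@bilin_snoc _ _ _ G 0)) linear0.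
have x0l (l : 'I_N) : antisym F (sder l x) = 0.
  have := congr1 (@lastc _ _ _ _ F l n) x0.
  by rewrite antisym_rec lastc_sum linear0.
rewrite antisym_rec big1 // => l _.
have [z /= hz e] := cartan_tensor l h.
have z0 : antisym F z = 0.
  by apply: (IH _ _ hz); rewrite linearZ /= x0l scaler0.
have := congr1 (@antisym _ _ _ _ F n.+1) e.
rewrite -coact_antisym x0 linear0 linearD /= z0 addr0 linearZ /=.
move/esym/(congr1 (fun t => (-1) ^+ n.+1 *: t)).
rewrite scalerA -exprMn mulrNN mulr1 expr1n scale1r scaler0 => ->.
by rewrite (bilin0l (@bilin_snoc _ _ _ G _)).
Qed.

Lemma extd_antisym n (x : T n) y :
  differential x y -> extd F (antisym F x) = antisym F y.
Proof.
move=> h; rewrite /extd; set D := (X in xget _ X).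
have : D (xget [::] D).
  have [s e] := word_span x.
  by apply: (@xgetPex _ [::] D); exists s; rewrite /D /= drepE -e.
move: (xget _ _) => s; rewrite /D /= drepE drep_dE => e.
apply/eqP; rewrite -subr_eq0.
rewrite -(linearB (@antisym _ _ _ _ F n.+1)); apply/eqP.
apply: (@diff_antisym0 _ (\sum_(p <- s) wordt p - x)).
  by apply: diff_sub => //; apply: diff_sum => p; apply: diff_word.
by rewrite linearB /= -e subrr.
Qed.

Lemma form_antisym n (theta : T n) :
  is_form F theta ->
  exists2 x, theta = antisym F x & exists y, differential x y.
Proof.
case=> c ->; exists (\sum_I c I ⊳ otens I).
  rewrite (linear_sumE _ _ _ (@antisym_linear _ _ _ _ F _));
    apply: eq_bigr => I _.
  by rewrite antisym_lact.
have [s ->] := word_span (\sum_I c I ⊳ otens I).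
by exists (\sum_(p <- s) wordt_d p); apply: diff_sum => p; apply: diff_word.
Qed.

Lemma cartan_formula (l : 'I_N) n (theta : T n) : is_form F theta ->
  lie l theta = contract l (extd F theta) + extd_contract l theta.
Proof.
case/form_antisym => x -> {theta} [y h]; have [z hz e] := cartan_tensor l h.
rewrite -[lie _ _]/(coact (chi F l) (antisym F x)) coact_antisym e.
rewrite linearD linearZ (extd_antisym h) contract_antisym; congr (_ + _).
case: n x y z h hz {e} => [|n] x y z h /= hz; first by rewrite hz linear0.
by rewrite contract_antisym -(extd_antisym hz) linearZ.
Qed.

End Exterior.

Theorem theorem2p4p11 (R : realType) (A : algType R[i]) (H : hopf_algebra A)
    (G : bicovariant_calculus H) (F : invariant_frame G) (i : 'I_(fdim F))
    (n : nat) (theta : tpow G n) :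
  is_form F theta ->
  lie i theta = contract i (extd F theta) + extd_contract i theta.
Proof. exact: cartan_formula. Qed.
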